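(* Let $p=5$, $a=2$ (so $q=25$) and $f(x)=x^8+x^6+x^2\in\mathbb{F}_{25}[x]$. Let $\xi\in\mathbb{F}_{25}$ be a root of $x^2+4x+2$ (so $\mathbb{F}_{25}=\mathbb{F}_5(\xi)$) and let $\lambda=\xi+2$. Then \[ \mathrm{NP}(f)\neq\mathrm{NP}(\lambda f). \]
   Context: Let $\mathbb{Q}_q$ be the unramified extension of $\mathbb{Q}_p$ of degree $a$, with ring of integers $\mathbb{Z}_q$, and fix a primitive $p$-th root of unity $\zeta_p\in\mathbb{C}_p$. For $g(x)\in\mathbb{F}_q[x]$ with $\gcd(\deg g,p)=1$, let $\hat g(x)\in\mathbb{Z}_q[x]$ be obtained by replacing each coefficient by its Teichmüller lift, and for $k\ge1$ set $S_g^*(k)=\sum_{x}\zeta_p^{\mathrm{Tr}_{\mathbb{Q}_{q^k}/\mathbb{Q}_p}(\hat g(x))}$, the sum over the Teichmüller lifts $x\in\mathbb{Z}_{q^k}^\times$ of the elements of $\mathbb{F}_{q^k}^\times$. Let $L_g^*(s)=\exp\big(\sum_{k\ge1}S_g^*(k)s^k/k\big)=\sum_{n=0}^{\deg g}c_ns^n$ (a polynomial of degree $\deg g$). The Newton polygon $\mathrm{NP}(g)$ is the lower convex hull of the points $(n,\mathrm{ord}_p c_n)$, with $\mathrm{ord}_p(p)=1$. *)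

(* Defs.v *)
From HB Require Import structures.
From mathcomp Require Import all_boot all_order all_algebra.
From mathcomp Require Import boolp classical_sets reals constructive_ereal.

Set Implicit Arguments.
Unset Strict Implicit.
Unset Printing Implicit Defensive.

Import Order.TTheory GRing.Theory Num.Theory.

Local Open Scope classical_set_scope.
Local Open Scope ring_scope.

Section Subfields.
Variable C : fieldType.

Record is_subfield (K : set C) : Prop := IsSubfield {
  subfield1 : K 1;
  subfieldB : forall x y, K x -> K y -> K (x - y);
  subfieldM : forall x y, K x -> K y -> K (x * y);
  subfieldV : forall x, K x -> K x^-1
}.

Definition is_basis (k K : set C) (n : nat) (b : 'rV[C]_n) : Prop :=
  [/\ forall i, K (b 0 i),
      forall x, K x -> exists2 c : 'I_n -> C,
        (forall i, k (c i)) & x = \sum_(i < n) c i * b 0 i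
    & forall c : 'I_n -> C, (forall i, k (c i)) ->
        \sum_(i < n) c i * b 0 i = 0 -> forall i, c i = 0].

Definition ext_degree (k K : set C) (n : nat) : Prop :=
  [/\ is_subfield K, k `<=` K & exists b : 'rV[C]_n, is_basis k K b].

(* [M] is the matrix, with entries in [k], of multiplication by [x] on [K]. *)
Definition is_trace (k K : set C) (x t : C) : Prop :=
  exists n (b : 'rV[C]_n) (M : 'M[C]_n),
    [/\ is_basis k K b, forall i j, k (M i j), x *: b = b *m M & t = \tr M].

Definition trace (k K : set C) (x : C) : C := xget 0 [set t | is_trace k K x t].

Definition algebraic_over (k : set C) (x : C) : Prop :=
  exists P : {poly C}, [/\ P != 0, forall i, k P`_i & root P x].

End Subfields.

Section Padic.
Variables (R : realType) (C : closedFieldType) (p : nat) (ord : C -> \bar R).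

Record is_valuation : Prop := IsValuation {
  ord_eqy : forall x, ord x = +oo%E <-> x = 0;
  ord_neqNy : forall x, ord x <> -oo%E;
  ordM : forall x y, ord (x * y) = (ord x + ord y)%E;
  ordD : forall x y, (Order.min (ord x) (ord y) <= ord (x + y))%E
}.

Definition ord_cauchy (u : nat -> C) : Prop :=
  forall A : R, exists N, forall m n, (N <= m)%N -> (N <= n)%N ->
    (A%:E <= ord (u m - u n))%E.

Definition ord_cvg (u : nat -> C) (l : C) : Prop :=
  forall A : R, exists N, forall n, (N <= n)%N -> (A%:E <= ord (u n - l))%E.

(* The closure of the prime field: inside C_p this is Q_p. *)
Definition Qp : set C :=
  [set x | forall A : R, exists r : rat, (A%:E <= ord (x - ratr r))%E].

(* (C, ord) is C_p, the completion of an algebraic closure of Q_p, with its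
   valuation normalized by ord p = 1; these properties characterize it up to
   isometric isomorphism. *)
Record is_Cp : Prop := IsCp {
  Cp_valuation : is_valuation;
  Cp_ord_p : ord p%:R = 1%:E;
  Cp_complete : forall u, ord_cauchy u -> exists l, ord_cvg u l;
  Cp_dense : forall (x : C) (A : R), exists2 y,
    algebraic_over Qp y & (A%:E <= ord (x - y))%E
}.

(* A subset of C with a candidate residue field and reduction map; [red] is
   only meaningful on the ring of integers of [ext_carrier]. *)
Record local_ext := LocalExt {
  ext_carrier : set C;
  resfield : finFieldType;
  red : C -> resfield
}.

Definition integers (K : local_ext) : set C :=
  [set x | ext_carrier K x /\ (0 <= ord x)%E].

Record is_reduction (K : local_ext) : Prop := IsReduction {
  red1 : red K 1 = 1;
  redB : forall x y, integers K x -> integers K y ->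
    red K (x - y) = red K x - red K y;
  redM : forall x y, integers K x -> integers K y ->
    red K (x * y) = red K x * red K y;
  red_surj : forall u, exists2 x, integers K x & red K x = u;
  red_eq0 : forall x, integers K x -> (red K x = 0 <-> (0 < ord x)%E)
}.

(* Unramified of degree n: both the extension of Q_p and the residue extension
   of F_p have degree n. *)
Record is_unramified (n : nat) (K : local_ext) : Prop := IsUnramified {
  unram_degree : ext_degree Qp (ext_carrier K) n;
  unram_reduction : is_reduction K;
  unram_resdegree : #|resfield K| = (p ^ n)%N
}.

Definition teichmuller (K : local_ext) (u : resfield K) : C :=
  xget 0 [set x | [/\ integers K x, x ^+ #|resfield K| = x & red K x = u]].

(* zeta ^ t for a p-th root of unity zeta and t in Z_p: any natural number
   congruent to t modulo p can serve as the exponent. *)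
Definition expZp (zeta t : C) : C :=
  zeta ^+ xget 0%N [set n : nat | (1%:E <= ord (t - n%:R))%E].

(* exp (\sum_(k >= 1) S k s^k / k): since the exponent has no constant term,
   only its terms k <= n and its powers j <= n contribute to s^n. *)
Definition exp_coef (S : nat -> C) (n : nat) : C :=
  (\sum_(j < n.+1) (j`!%:R)^-1 *:
     (\sum_(1 <= k < n.+1) (S k / k%:R) *: 'X^k) ^+ j)`_n.

Section LFunction.
(* Q n stands for Q_(p^n), n > 0, with its residue field F_(p^n). *)
Variables (zeta : C) (Q : nat -> local_ext) (a : nat).
Variable g : {poly resfield (Q a)}.

Definition teichmuller_poly : {poly C} := map_poly (@teichmuller (Q a)) g.

Definition exp_sum (k : nat) : C :=
  \sum_(u : resfield (Q (a * k)) | u != 0)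
    expZp zeta (trace Qp (ext_carrier (Q (a * k)))
                  teichmuller_poly.[teichmuller u]).

Definition L_coef : nat -> C := exp_coef exp_sum.

(* Points (n, ord c_n) at infinite height (c_n = 0) are left out. *)
Definition newton_points : set (R * R) :=
  [set P | exists n : nat,
     [/\ (n <= (size g).-1)%N, P.1 = n%:R & ord (L_coef n) = (P.2)%:E]].

End LFunction.
End Padic.

Section LowerHull.
Variable R : realType.

Definition conv_hull (A : set (R * R)) : set (R * R) :=
  [set P | exists m (t : 'I_m -> R) (v : 'I_m -> R * R),
     [/\ forall i, 0 <= t i, \sum_(i < m) t i = 1, forall i, A (v i),
         P.1 = \sum_(i < m) t i * (v i).1 & P.2 = \sum_(i < m) t i * (v i).2]].

Definition lower_hull (A : set (R * R)) : set (R * R) :=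
  [set P | conv_hull A P /\ forall y, conv_hull A (P.1, y) -> P.2 <= y].

End LowerHull.

Definition NP (R : realType) (C : closedFieldType) (ord : C -> \bar R)
    (zeta : C) (Q : nat -> local_ext C) (a : nat) (g : {poly resfield (Q a)}) :
    set (R * R) :=
  lower_hull (newton_points ord zeta g).

(* Main.v *)
(** Write f(x) = h(x^2) with h(y) = y^4 + y^3 + y, and note lambda^2 = 2. Counting
    square roots splits the exponential sums of mu f into those of mu h weighted by
    the trivial and by the quadratic character, so the L-function is a product
    of two L-functions. By the Euler product, each coefficient A_n of such a factor
    is a sum, over the monic polynomials u of degree n over F_25, of a multiplicative
    function of u that only involves u(0) and the power sums p_1, p_3, p_4 of the
    roots of u. Translating the coefficient of degree n - 4 shows A_n = 0 for n > 4; in degree 4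
    the constant coefficient can be summed out; degrees at most 3 are finite sums over
    F_25^3, evaluated by computation.

    The values found give ord c_n >= 3n/4 - 1 for f, with equality at n = 3, so that
    (3, 5/4) is a point of NP(f); for lambda f they give ord c_n >= n - 3/2, so that
    NP(lambda f) lies above 3/2 at abscissa 3.

    The p-adic definition of the sums is reduced to residue fields by an integral
    basis of Q_(p^n) lifting a basis of the residue field: the trace reduces modulo p
    to the residue trace, and x^(q^n) converges to the Teichmueller representative. *)
Require Import Defs.
From HB Require Import structures.
From mathcomp Require Import all_boot all_order all_algebra all_field.
From mathcomp Require Import boolp classical_sets reals constructive_ereal.
From mathcomp Require Import ring lra zify.

Set Implicit Arguments.
Unset Strict Implicit.
Unset Printing Implicit Defensive.

Import Order.TTheory GRing.Theory Num.Theory.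

Local Open Scope ring_scope.

(** * Monic and irreducible polynomials over a finite field *)

Section Monics.
Variable F : finFieldType.
Implicit Types (u v P : {poly F}) (n : nat).

(** Bounds on c_n are needed in every degree up to 8. Applied directly to f, the sums over monic
    polynomials would have about 25^7 terms; splitting over squares leaves two factors of degree at
    most 4, within reach of computation. No infinite product is formed. In characteristic 0 the
    coefficients are determined by c_0 = 1 and n c_n = sum_k S_k c_(n-k), and the Euler product
    becomes a count: a monic u of degree n has exactly n points x, taken in all the fields F_(25^k)
    together, whose characteristic polynomial over F_25 divides u. The fields F_(25^k) are never
    embedded in one another; each only receives F_25. The finite sums are integer vectors on the
    powers of zeta, so their valuations become divisibility tests with respect to 5 and zeta - 1. *)

Definition monics n : seq {poly F} :=
  [seq Poly (rcons (t : n.-tuple F) 1) | t <- enum {: n.-tuple F}].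

Lemma polyseq_monic (s : seq F) : Poly (rcons s 1) = rcons s 1 :> seq F.
Proof. by rewrite (PolyK (c := 1)) // last_rcons oner_eq0. Qed.

Lemma mem_monics n u : (u \in monics n) = (u \is monic) && (size u == n.+1).
Proof.
apply/mapP/andP => [[t _ ->]|[mu /eqP su]].
  rewrite monicE lead_coefE polyseq_monic size_rcons size_tuple.
  by rewrite nth_rcons size_tuple ltnn !eqxx.
have sz : size (take n u) == n by rewrite size_take su leqnn.
exists (Tuple sz); first by rewrite mem_enum.
apply: poly_inj; rewrite polyseq_monic /=.
have := mu; rewrite monicE lead_coefE su /= => /eqP <-.
by rewrite -take_nth ?su // take_oversize ?su.
Qed.

Lemma uniq_monics n : uniq (monics n).
Proof.
rewrite map_inj_uniq ?enum_uniq // => s t /(congr1 (polyseq (R := F))).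
rewrite !polyseq_monic => /eqP; rewrite eqseq_rcons eqxx andbT => /eqP.
exact: val_inj.
Qed.

Lemma monic_mem_monics u : u \is monic -> u \in monics (size u).-1.
Proof.
by move=> mu; rewrite mem_monics mu prednK ?eqxx // size_poly_gt0 monic_neq0.
Qed.

Lemma monics0 : monics 0 = [:: 1].
Proof.
have m1 u : u \in monics 0 = (u == 1).
  rewrite mem_monics; apply/andP/eqP => [[mu /eqP su]|->]; last first.
    by rewrite monic1 size_poly1.
  have := size1_polyC (eq_leq su); move: mu; rewrite monicE lead_coefE su /=.
  by move=> /eqP -> ->.
apply: perm_small_eq => //; apply: uniq_perm => //; first exact: uniq_monics.
by move=> u; rewrite m1 inE.
Qed.

Lemma normalize_monic u : u != 0 ->
  (lead_coef u)^-1 *: u \is monic /\ size ((lead_coef u)^-1 *: u) = size u.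
Proof.
move=> u0; rewrite monicE lead_coefZ mulVf ?lead_coef_eq0 //.
by rewrite size_scale // invr_eq0 lead_coef_eq0.
Qed.

(** A proper factorization of a monic polynomial of least degree in [A] would put a factor of
    smaller degree in [A]. It serves for two predicates: not being coprime to a given polynomial,
    and vanishing at a given point of an extension. *)
Lemma least_monic_irreducible (A : pred {poly F}) u :
  (forall p q, A (p * q) -> A p || A q) ->
  (forall c p, c != 0 -> A p -> A (c *: p)) ->
  ~~ A 1 -> u \is monic -> A u ->
  exists P, [/\ P \is monic, irreducible_poly P & A P].
Proof.
move=> AM AZ A1 mu Au.
have exm : exists n, has A (monics n).
  by exists (size u).-1; apply/hasP; exists u; rewrite ?monic_mem_monics.
case: (ex_minnP exm) => n /hasP[P]; rewrite mem_monics => /andP[mP /eqP sP] AP minn.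
have sA v : v != 0 -> A v -> (n < size v)%N.
  move=> v0 Av; have [m s] := normalize_monic v0.
  have /minn : has A (monics (size v).-1).
    apply/hasP; exists ((lead_coef v)^-1 *: v).
      by rewrite -s monic_mem_monics.
    by rewrite AZ // invr_eq0 lead_coef_eq0.
  by rewrite -ltnS prednK // size_poly_gt0.
have P0 := monic_neq0 mP.
exists P; split=> //; split.
  rewrite ltnNge; apply: contra A1 => sP1; have := monic_mem_monics mP.
  have -> : (size P).-1 = 0%N by case: (size P) sP1 => [|[]].
  by rewrite monics0 inE => /eqP <-.
move=> q sq /dvdpP[r PE].
have [r0 q0] : r != 0 /\ q != 0.
  by apply/andP; rewrite -negb_or -mulf_eq0 -PE.
have := AM r q; rewrite -PE => /(_ AP) /orP[Ar|Aq].
  have := sA r r0 Ar; have := size_mul r0 q0; rewrite -PE sP.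
  move: sq; have : size q != 0%N by rewrite size_poly_eq0.
  by case: (size q) => [|[|k]] // _ _; rewrite !addnS /= => -[->]; rewrite ltnNge leq_addr.
rewrite -dvdp_size_eqp ?PE ?dvdp_mulIr // -PE eqn_leq dvdp_leq ?PE ?dvdp_mulIr //=.
  by rewrite -PE sP sA.
by rewrite -PE.
Qed.

Lemma monic_irreducible_factor u : u \is monic -> (1 < size u)%N ->
  exists P, [/\ P \is monic, irreducible_poly P & P %| u].
Proof.
move=> mu su.
have [|||||P [mP iP nP]] := @least_monic_irreducible (fun p => ~~ coprimep p u) u.
- by move=> p q; rewrite coprimepMl negb_and.
- by move=> c p c0; rewrite coprimepZl.
- by rewrite coprime1p.
- by [].
- by rewrite coprimepp gtn_eqF.
by exists P; split=> //; move: nP; rewrite irreducible_poly_coprime // negbK.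
Qed.

End Monics.

(** * Conjugates and characteristic polynomials in an extension *)

Lemma card_pchar_nat (F : finFieldType) (E : fieldType) (f : {rmorphism F -> E}) :
  [pchar E].-nat #|F|.
Proof.
have [p pr_p chp] := finPcharP F.
have -> : #|F| = (p ^ logn p #|F|)%N by exact: (card_pprimeChar chp).
by rewrite pnatX pnatE // (rmorph_pchar f) // ?chp.
Qed.

Lemma expf_card_exp (E : finFieldType) (x : E) j : x ^+ (#|E| ^ j) = x.
Proof. by elim: j => [|j IH]; rewrite ?expr1 // expnS exprM expf_card. Qed.

(** The class of X lies in the field F[X]/(P), whose cardinal is q^(deg P), so raising it to the
    power q^(j deg P) fixes it. *)
Lemma irreducible_dvd_Xqn (F : finFieldType) (P : {poly F}) j :
  P \is monic -> irreducible_poly P ->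
  P %| 'X^(#|F| ^ ((size P).-1 * j)) - 'X.
Proof.
move=> mP iP; pose hI : monic_irreducible_poly P := (iP, mP).
pose x : {poly %/ P with hI} := in_qpoly P 'X.
have : x ^+ (#|{poly %/ P with hI}| ^ j) = x by exact: expf_card_exp.
rewrite card_qfpoly -expnM => /eqP; rewrite -subr_eq0.
set m := (_ ^ _)%N => /eqP x0.
have : in_qpoly P ('X^m - 'X) = 0 by rewrite rmorphB rmorphXn.
move=> /(congr1 val) /=; rewrite mk_monicE // => r0.
by rewrite dvdpE; apply/eqP.
Qed.

Section Conjugates.
Variables (F E : finFieldType) (iota : {rmorphism F -> E}) (k : nat).
Hypotheses (k_gt0 : (0 < k)%N) (card_E : #|E| = (#|F| ^ k)%N).
Local Notation q := #|F|.
Local Notation "p ^iota" := (map_poly iota p) (at level 2, format "p ^iota").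

(** The q images of elements of [F] already exhaust the roots of X^q - X. *)
Lemma fixed_in_image (y : E) : y ^+ q = y -> exists a, iota a = y.
Proof.
move=> yq; case: (pickP (fun a => iota a == y)) => [a /eqP <-|no]; first by exists a.
pose rs := y :: [seq iota a | a <- enum F].
have urs : uniq rs.
  rewrite /= map_inj_uniq ?enum_uniq ?andbT; last exact: fmorph_inj.
  by apply/mapP => -[a _ ya]; have := no a; rewrite ya eqxx.
have sz : size ('X^q - 'X : {poly E}) = q.+1.
  by rewrite size_polyDl size_polyXn // size_polyN size_polyX ltnS finNzRing_gt1.
have := @max_poly_roots _ ('X^q - 'X) rs; rewrite -size_poly_eq0 sz.
move=> /(_ isT); rewrite /= size_map -cardE ltnn => /(_ _ urs) H.
suff: false by []; apply: H; rewrite rootE !hornerE yq subrr eqxx /=.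
apply/allP => _ /mapP[a _ ->].
by rewrite rootE !hornerE -rmorphXn expf_card subrr.
Qed.

Definition frob (x : E) : E := x ^+ q.

Fact frob_is_zmod : zmod_morphism frob.
Proof.
move=> x y; rewrite /frob exprDn_pchar ?exprNn_pchar //; exact: card_pchar_nat iota.
Qed.

Fact frob_is_monoid : monoid_morphism frob.
Proof. by split=> [|x y]; rewrite /frob ?expr1n ?exprMn. Qed.

HB.instance Definition _ := GRing.isZmodMorphism.Build E E frob frob_is_zmod.
HB.instance Definition _ := GRing.isMonoidMorphism.Build E E frob frob_is_monoid.

Definition conj_poly (x : E) : {poly E} :=
  \prod_(i < k) ('X - (x ^+ (q ^ i))%:P).

(** Inverse of [iota] on its image. The coefficients of [conj_poly] are fixed by Frobenius, so they
    never meet the default value. *)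
Definition descend (y : E) : F := odflt 0 [pick a | iota a == y].

Lemma descendK (y : E) : frob y = y -> iota (descend y) = y.
Proof.
move=> /fixed_in_image[a ay]; rewrite /descend.
by case: pickP => [b /eqP //|/(_ a)]; rewrite ay eqxx.
Qed.

Lemma descend0 : descend 0 = 0.
Proof.
by apply: (fmorph_inj iota); rewrite descendK ?rmorph0 // /frob expr0n gtn_eqF.
Qed.

(* The characteristic polynomial over F of multiplication by x. *)
Definition frob_charpoly (x : E) : {poly F} := map_poly descend (conj_poly x).

Lemma frob_iter_k (x : E) : x ^+ (q ^ k) = x.
Proof. by rewrite -card_E expf_card. Qed.

Lemma conj_poly_frob x : map_poly frob (conj_poly x) = conj_poly x.
Proof.
rewrite /conj_poly rmorph_prod -(prednK k_gt0) big_ord_recr [RHS]big_ord_recl mulrC /=.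
congr (_ * _); last first.
  by rewrite rmorphB /= map_polyX map_polyC /= /frob -exprM -expnSr prednK // frob_iter_k expr1.
apply: eq_bigr => i _; rewrite rmorphB /= map_polyX map_polyC /= /frob.
by rewrite -exprM -expnSr.
Qed.

Lemma frob_charpolyE x : (frob_charpoly x)^iota = conj_poly x.
Proof.
apply/polyP => i; rewrite coef_map /= /frob_charpoly coef_map_id0 ?descend0 //.
by rewrite descendK // -[in RHS]conj_poly_frob coef_map.
Qed.

Lemma size_conj_poly x : size (conj_poly x) = k.+1.
Proof. by rewrite size_prod_XsubC /index_enum -enumT size_enum_ord. Qed.

Lemma conj_poly_monic x : conj_poly x \is monic.
Proof. exact: monic_prod_XsubC. Qed.

Lemma frob_charpoly_monic x : frob_charpoly x \is monic.
Proof. by rewrite -(map_monic iota) frob_charpolyE conj_poly_monic. Qed.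

Lemma size_frob_charpoly x : size (frob_charpoly x) = k.+1.
Proof. by rewrite -(size_map_poly iota) frob_charpolyE size_conj_poly. Qed.

Lemma root_conj_poly x y :
  root (conj_poly x) y = [exists i : 'I_k, y == x ^+ (q ^ i)].
Proof.
rewrite /conj_poly -(big_map (fun i : 'I_k => x ^+ (q ^ i)) xpredT
  (fun y => 'X - y%:P)) root_prod_XsubC.
by apply/mapP/existsP => [[i _ ->]|[i /eqP ->]]; exists i; rewrite ?mem_index_enum.
Qed.

Lemma root_frob (P : {poly F}) x i : root P^iota x -> root P^iota (x ^+ (q ^ i)).
Proof.
move=> rx; elim: i => [|i IH]; first by rewrite expr1.
rewrite expnSr exprM -[_ ^+ q]/(frob _).
have -> : P^iota = map_poly frob P^iota.
  by apply/polyP => j; rewrite !coef_map /= /frob -rmorphXn expf_card.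
by rewrite fmorph_root.
Qed.

Lemma minimal_poly_exists x :
  exists P : {poly F}, [/\ P \is monic, irreducible_poly P & root P^iota x].
Proof.
apply: (@least_monic_irreducible _ (fun p => root p^iota x) (frob_charpoly x)).
- by move=> p r; rewrite rmorphM rootM.
- by move=> c p c0; rewrite map_polyZ rootZ // fmorph_eq0.
- by rewrite rmorph1 root1.
- exact: frob_charpoly_monic.
rewrite frob_charpolyE root_conj_poly; apply/existsP.
by exists (Ordinal k_gt0); rewrite expr1.
Qed.

(** Divide by the largest power of [P]. A nonconstant cofactor would vanish at some conjugate of x,
    which is also a root of [P], against coprimality. *)
Lemma frob_charpoly_power (P : {poly F}) x :
  P \is monic -> irreducible_poly P -> root P^iota x ->
  exists2 j, k = (j * (size P).-1)%N & frob_charpoly x = P ^+ j.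
Proof.
move=> mP iP rx; set u := frob_charpoly x.
have P1 : (1 < size P)%N by case: iP.
have exj : exists j, P ^+ j %| u by exists 0%N; rewrite dvd1p.
have u0 : u != 0 by exact/monic_neq0/frob_charpoly_monic.
have szX j : size (P ^+ j) = ((size P).-1 * j).+1.
  by rewrite -size_exp prednK // size_poly_gt0 expf_neq0 // monic_neq0.
have bnd j : P ^+ j %| u -> (j <= k)%N.
  move=> /(dvdp_leq u0); rewrite szX size_frob_charpoly ltnS; apply: leq_trans.
  by rewrite leq_pmull // -ltnS prednK // ltnW.
case: (ex_maxnP exj bnd) => j Pju maxj.
have [w uE] := dvdpP _ _ Pju.
have mw : w \is monic by have := frob_charpoly_monic x; rewrite -/u uE monicMr // monic_exp.
have cPw : coprimep P w.
  rewrite irreducible_poly_coprime //; apply/negP => /dvdpP[r wE].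
  by have := maxj j.+1; rewrite uE wE -mulrA -exprS dvdp_mull // ltnn => /(_ isT).
have w1 : w = 1.
  apply/eqP; apply: contraT => w1.
  have sw : size w^iota != 1%N by rewrite size_map_poly size_poly_eq1 eqp_monic ?monic1.
  have wd : w^iota %| conj_poly x by rewrite -frob_charpolyE -/u uE rmorphM dvdp_mulr.
  have [m wm] := dvdp_prod_XsubC wd.
  move: sw; rewrite (eqp_size wm) size_prod_XsubC; case: (mask _ _) wm => // i s wm _.
  have rw : root w^iota (x ^+ (q ^ i)).
    by rewrite (eqp_root wm) big_cons rootM root_XsubC eqxx.
  have /coprimep_root : coprimep P^iota w^iota by rewrite coprimep_map.
  by move/(_ _ (root_frob i rx)); rewrite -rootE rw.
exists j; last by rewrite uE w1 mul1r.
by have := szX j; have := size_frob_charpoly x; rewrite -/u uE w1 mul1r => -> [->]; rewrite mulnC.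
Qed.

(** [P] divides X^|E| - X, the product of all X - x, so it splits in [E] with distinct roots. *)
Lemma card_roots_irreducible (P : {poly F}) j : P \is monic -> irreducible_poly P ->
  k = (j * (size P).-1)%N -> #|[set x | root P^iota x]| = (size P).-1.
Proof.
move=> mP iP kE.
have : P^iota %| \prod_(x : E) ('X - x%:P).
  rewrite -finField_genPoly card_E kE mulnC.
  have := irreducible_dvd_Xqn j mP iP; rewrite -(dvdp_map iota).
  by rewrite rmorphB /= map_polyXn map_polyX.
move=> /dvdp_prod_XsubC[m wm].
set s := mask m _ in wm; have us : uniq s by rewrite mask_uniq // index_enum_uniq.
have -> : [set x | root P^iota x] = [set x in s].
  by apply/finset.setP => x; rewrite !inE (eqp_root wm) root_prod_XsubC.
by rewrite cardsE (card_uniqP us) -(size_map_poly iota) (eqp_size wm) size_prod_XsubC.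
Qed.

End Conjugates.

(** * The Euler product *)

Section EulerProduct.
Variables (F : finFieldType) (E : nat -> finFieldType).
Variable iota : forall k, {rmorphism F -> E k}.
Hypothesis card_E : forall k, (0 < k)%N -> #|E k| = (#|F| ^ k)%N.

Local Notation chi k x := (frob_charpoly (iota k) k x).
Local Notation roots_dividing k u := [set x : E k | chi k x %| u].

(** Let e be the multiplicity of [P] in [v]. A characteristic polynomial that divides [P * v] but
    not [v] must be P^(e+1); this occurs only in degree k0 = (e+1) deg P, and there exactly for the
    deg P roots of [P]. The bound on [k0] keeps it within the range of the sum below. *)
Lemma card_dividing_mul (P v : {poly F}) :
  P \is monic -> irreducible_poly P -> v \is monic ->
  exists k0, [/\ (0 < k0)%N, (k0 < size (P * v)%R)%N &
    forall k, (0 < k)%N -> #|roots_dividing k (P * v)| =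
      (#|roots_dividing k v| + (k == k0) * (size P).-1)%N].
Proof.
move=> mP iP mv.
have P1 : (1 < size P)%N by case: iP.
have d0 : (0 < (size P).-1)%N by rewrite -ltnS prednK // ltnW.
have P0 := monic_neq0 mP; have v0 := monic_neq0 mv.
have szX j : size (P ^+ j) = ((size P).-1 * j).+1.
  by rewrite -size_exp prednK // size_poly_gt0 expf_neq0.
have exj : exists j, P ^+ j %| v by exists 0%N; rewrite dvd1p.
have bnd j : P ^+ j %| v -> (j <= size v)%N.
  move=> /(dvdp_leq v0); rewrite szX; apply: leq_trans.
  by rewrite ltnW // ltnS leq_pmull.
case: (ex_maxnP exj bnd) => e Pev maxe.
have dvdv j : P ^+ j %| v -> (j <= e)%N by exact: maxe.
have dvdPv j : P ^+ j %| P * v -> (j <= e.+1)%N.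
  by case: j => // j; rewrite exprS dvdp_mul2l // ltnS; apply: dvdv.
exists (e.+1 * (size P).-1)%N; split; first by rewrite muln_gt0.
  have : P ^+ e.+1 %| P * v by rewrite exprS dvdp_mul2l.
  by move=> /(dvdp_leq (mulf_neq0 P0 v0)); rewrite szX mulnC.
move=> k k0.
have sub : roots_dividing k v \subset roots_dividing k (P * v).
  by apply/fintype.subsetP => x; rewrite !inE => /dvdp_mull.
rewrite -(cardsID (roots_dividing k v) (roots_dividing k (P * v))).
rewrite (finset.setIidPr sub); congr (_ + _)%N.
have diff x : x \in roots_dividing k (P * v) :\: roots_dividing k v ->
  root (map_poly (iota k) P) x /\ k = (e.+1 * (size P).-1)%N.
  rewrite !inE => /andP[nxv xPv].
  have [Q [mQ iQ rQ]] := minimal_poly_exists (iota k) k0 (card_E k0) x.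
  have [j kE cE] := frob_charpoly_power k0 (card_E k0) mQ iQ rQ.
  (* A power of another irreducible polynomial is coprime to [P], so it would already divide [v]. *)
  have QP : Q = P.
    apply/eqP; rewrite -eqp_monic //; apply: contraT => nQP.
    move: nxv; rewrite cE; rewrite cE Gauss_dvdpr in xPv; first by rewrite xPv.
    rewrite coprimep_expl // irreducible_poly_coprime //.
    by apply: contra nQP => /(apply_irredp iP); apply; case: iQ; case: (size Q) => [|[]].
  subst Q; split=> //; rewrite kE; congr (_ * _)%N; apply/eqP.
  rewrite eqn_leq dvdPv -?cE //= ltnNge; apply: contra nxv => je.
  by rewrite cE (dvdp_trans (dvdp_exp2l _ je)).
case: eqP => [kE|nk]; last first.
  by apply/eqP; rewrite mul0n cards_eq0; apply/set0Pn => -[x /diff[_ /nk]].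
rewrite mul1n -(card_roots_irreducible (iota k) (card_E k0) mP iP kE); congr #|pred_of_set _|.
apply/finset.setP => x; rewrite [in RHS]inE; apply/idP/idP => [/diff[]//|rx].
have [j kE' cE] := frob_charpoly_power k0 (card_E k0) mP iP rx.
have je : j = e.+1 by apply/eqP; rewrite -(eqn_pmul2r d0) -kE kE'.
rewrite !inE cE je; apply/andP; split; last by rewrite exprS dvdp_mul2l.
by apply/negP => /dvdv; rewrite ltnn.
Qed.

(** An irreducible [P] of multiplicity e in [u] accounts for deg P points in each of the degrees deg
    P, 2 deg P, ..., e deg P. The induction removes one factor [P] at a time. *)
Lemma sum_card_dividing (u : {poly F}) n : u \is monic -> (size u <= n.+1)%N ->
  (\sum_(1 <= k < n.+1) #|roots_dividing k u| = (size u).-1)%N.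
Proof.
have [m] := ubnP (size u); elim: m u => // m IH u su mu sun.
have [su1|su1] := leqP (size u) 1.
  have -> : (size u).-1 = 0%N by case: (size u) su1 => [|[]].
  rewrite big_nat big1 // => k /andP[k0 _]; apply/eqP; rewrite cards_eq0.
  apply/set0Pn => -[x]; rewrite inE => /(dvdp_leq (monic_neq0 mu)).
  rewrite size_frob_charpoly ?card_E //.
  by move/leq_trans/(_ su1); rewrite ltnS leqNgt k0.
have [P [mP iP /dvdpP[v uE]]] := monic_irreducible_factor mu su1.
have mv : v \is monic by rewrite -(monicMr _ mP) -uE.
have P0 := monic_neq0 mP; have v0 := monic_neq0 mv.
have P1 : (1 < size P)%N by case: iP.
have szu : size u = (size P + size v).-1 by rewrite uE mulrC size_mul.
have svu : (size v < size u)%N.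
  by rewrite szu; case: (size P) P1 => [|[|a]] // _; rewrite !addSn ltnS leq_addl.
have [k0 [k0_gt0 k0s cnt]] := card_dividing_mul mP iP mv.
rewrite mulrC -uE in cnt; rewrite mulrC -uE in k0s.
have -> : (\sum_(1 <= k < n.+1) #|roots_dividing k u| =
  \sum_(1 <= k < n.+1) (#|roots_dividing k v| + (k == k0) * (size P).-1))%N.
  by rewrite big_nat [RHS]big_nat; apply: eq_bigr => k /andP[kk _]; exact: cnt.
rewrite big_split /= IH //; last first.
- by rewrite (leq_trans (ltnW svu)).
- by rewrite (leq_trans svu).
rewrite (bigD1_seq k0) ?iota_uniq //=; last first.
  by rewrite mem_index_iota k0_gt0 (leq_trans k0s).
rewrite eqxx mul1n big1 ?addn0; last by move=> k /negbTE ->.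
rewrite szu; case: (size P) P1 => // a _; have : (0 < size v)%N by rewrite size_poly_gt0.
by case: (size v) => // b _; rewrite addSn addnS /= addnC.
Qed.

Variables (R : comNzRingType) (Psi : {poly F} -> R).
Hypothesis PsiM : forall u v, u \is monic -> v \is monic -> Psi (u * v) = Psi u * Psi v.

Definition monic_sum n : R := \sum_(u <- monics F n) Psi u.
Definition point_sum k : R := \sum_(x : E k) Psi (chi k x).

Lemma monics_multiples (c : {poly F}) k n : c \is monic -> size c = k.+1 -> (k <= n)%N ->
  perm_eq [seq c * v | v <- monics F (n - k)] [seq u <- monics F n | c %| u].
Proof.
move=> mc sc kn; have c0 := monic_neq0 mc.
apply: uniq_perm; rewrite ?filter_uniq ?uniq_monics //.
  by rewrite map_inj_uniq ?uniq_monics //; apply: mulfI.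
move=> u; rewrite mem_filter mem_monics.
apply/mapP/idP => [[v]|/and3P[/dvdpP[v ->] mu /eqP su]].
  rewrite mem_monics => /andP[mv /eqP sv] ->; rewrite dvdp_mulIl monicMl // mv.
  by rewrite size_mul ?(monic_neq0 mv) // sc sv addSn addnS subnKC /=.
exists v; last by rewrite mulrC.
have mv : v \is monic by rewrite -(monicMr _ mc).
rewrite mem_monics mv; move: su; rewrite size_mul ?(monic_neq0 mv) // sc addnS /=.
by move=> su; rewrite -(eqn_add2r k) su addSn subnK.
Qed.

(** The factor n counts the points (k, x) whose characteristic polynomial c divides u; writing u = c
    v and exchanging the sums factors [Psi]. *)
Theorem euler_recurrence n :
  monic_sum n *+ n = \sum_(1 <= k < n.+1) point_sum k * monic_sum (n - k).
Proof.
transitivity (\sum_(u <- monics F n)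
   \sum_(1 <= k < n.+1) \sum_(x : E k | chi k x %| u) Psi u).
  rewrite /monic_sum -sumrMnl big_seq [RHS]big_seq; apply: eq_bigr => u.
  rewrite mem_monics => /andP[mu /eqP su].
  have := @sum_card_dividing u n mu (eq_leq su); rewrite su /= => {1}<-.
  rewrite -sumrMnr; apply: eq_bigr => k _.
  by rewrite -sumr_const; apply: eq_bigl => x; rewrite inE.
rewrite exchange_big /= big_nat [RHS]big_nat; apply: eq_bigr => k /andP[k0 kn].
under eq_bigr do rewrite big_mkcond.
rewrite exchange_big /= mulr_suml; apply: eq_bigr => x _.
have mc := frob_charpoly_monic (iota k) k0 (card_E k0) x.
have sc := size_frob_charpoly (iota k) k0 (card_E k0) x.
rewrite -big_mkcond -big_filter -(perm_big _ (monics_multiples mc sc kn)) /=.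
rewrite big_map mulr_sumr big_seq [RHS]big_seq; apply: eq_bigr => v.
by rewrite mem_monics => /andP[mv _]; rewrite PsiM.
Qed.

End EulerProduct.

(** * Coefficients of the exponential *)

Section ExpCoef.
Variable C : closedFieldType.
Hypothesis char0 : forall n, (0 < n)%N -> n%:R != 0 :> C.
Variable S : nat -> C.

Let logp N : {poly C} := \sum_(1 <= k < N.+1) (S k / k%:R) *: 'X^k.
(** Two separate truncation orders, because differentiation lowers that of the exponential, [J], and
    leaves that of the logarithm, [N]. *)
Let texp J N : {poly C} := \sum_(j < J.+1) (j`!%:R)^-1 *: logp N ^+ j.

Let coef_logp N i : (logp N)`_i = if (0 < i <= N)%N then S i / i%:R else 0.
Proof.
rewrite coef_sum; case: ifP => iN.
  rewrite (bigD1_seq i) ?iota_uniq ?mem_index_iota //= coefZ coefXn eqxx mulr1.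
  by rewrite big1 ?addr0 // => k ki; rewrite coefZ coefXn eq_sym (negbTE ki) mulr0.
rewrite big_nat big1 // => k kN; rewrite coefZ coefXn; case: eqP => [ik|]; last by rewrite mulr0.
by move: kN; rewrite -ik ltnS iN.
Qed.

Let coef_dvdXn (p : {poly C}) n m : 'X^n %| p -> (m < n)%N -> p`_m = 0.
Proof. by move=> /dvdpP[r ->] mn; rewrite coefMXn mn. Qed.

Let dvd_Xn (p : {poly C}) n : (forall i, (i < n)%N -> p`_i = 0) -> 'X^n %| p.
Proof.
move=> p0; apply/dvdpP; exists (\poly_(i < size p) p`_(i + n)).
apply/polyP => i; rewrite coefMXn; case: ltnP => [/p0 //|ni].
rewrite coef_poly subnK //; case: ltnP => // sp.
by rewrite nth_default // (leq_trans sp) // leq_subr.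
Qed.

Let coef_texp J N m : (m <= J)%N -> (m <= N)%N -> (texp J N)`_m = exp_coef S m.
Proof.
move=> mJ mN; rewrite /exp_coef -/(logp m) /texp !coef_sum.
rewrite (big_ord_widen_cond J.+1 xpredT (fun j => ((j`!%:R)^-1 *: logp m ^+ j)`_m)) //=.
rewrite [RHS]big_mkcond /=; apply: eq_bigr => j _; rewrite !coefZ; case: ltnP => jm.
  congr (_ * _); apply/eqP; rewrite -subr_eq0 -coefB; apply/eqP.
  apply: (@coef_dvdXn _ m.+1) => //; rewrite subrXX dvdp_mulr // dvd_Xn // => i im.
  move: im; rewrite ltnS => im.
  by rewrite coefB !coef_logp im (leq_trans im mN) subrr.
rewrite (@coef_dvdXn _ j) ?mulr0 //; apply: dvdp_exp2r.
by apply: (@dvd_Xn _ 1) => -[|//] _; rewrite coef_logp.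
Qed.

Lemma exp_coef0 : exp_coef S 0 = 1.
Proof. by rewrite /exp_coef big_ord1 expr0 fact0 invr1 scale1r coef1. Qed.

(** This is E' = L' E for E = exp L, read on truncations. *)
Lemma exp_coef_recurrence n :
  exp_coef S n *+ n = \sum_(1 <= k < n.+1) S k * exp_coef S (n - k).
Proof.
case: n => [|n]; first by rewrite mulr0n big_geq.
rewrite -(@coef_texp n.+1 n.+1) // -coef_deriv.
have -> : (texp n.+1 n.+1)^`() = (logp n.+1)^`() * texp n n.+1.
  rewrite /texp big_ord_recl expr0 fact0 invr1 scale1r derivD raddf_sum.
  rewrite derivC add0r mulr_sumr; apply: eq_bigr => j _.
  rewrite /= derivZ deriv_exp /= /bump /= add1n factS natrM invfM.
  rewrite -scaler_nat scalerA -mulrA.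
  by rewrite add0n mulrC mulfK ?char0 // scalerAr.
rewrite coefM big_add1 /= big_mkord; apply: eq_bigr => i _.
have := ltn_ord i; rewrite ltnS => le_in.
rewrite subSS coef_texp ?leq_subr //; last by rewrite leqW // leq_subr.
congr (_ * _); rewrite coef_deriv coef_logp /= ltnS le_in -[LHS]mulr_natr.
by rewrite divfK ?char0.
Qed.

Lemma recurrence_unique (c : nat -> C) :
  c 0%N = 1 ->
  (forall n, c n *+ n = \sum_(1 <= k < n.+1) S k * c (n - k)%N) ->
  forall n, exp_coef S n = c n.
Proof.
move=> c0 cS n; have [m] := ubnP n; elim: m n => // m IH [|n] nm.
  by rewrite exp_coef0.
apply: (mulIf (char0 (ltn0Sn n))); rewrite !mulr_natr exp_coef_recurrence cS.
rewrite big_nat [RHS]big_nat; apply: eq_bigr => k /andP[k0 kn].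
by rewrite IH // (leq_trans _ (nm : (n.+1 <= m)%N)) // ltn_subrL k0.
Qed.

End ExpCoef.

(** With generating series, the recurrences read X a' = S a and X b' = T b, and X d/dX is a
    derivation. Cutting the series at degree n leaves the coefficients up to degree n of their
    products intact. *)
Lemma convolution_recurrence (R : comNzRingType) (S T a b : nat -> R) :
  (forall n, a n *+ n = \sum_(1 <= k < n.+1) S k * a (n - k)%N) ->
  (forall n, b n *+ n = \sum_(1 <= k < n.+1) T k * b (n - k)%N) ->
  let c n := \sum_(i < n.+1) a i * b (n - i)%N in
  forall n, c n *+ n = \sum_(1 <= k < n.+1) (S k + T k) * c (n - k)%N.
Proof.
move=> ha hb c n.
pose trunc (f : nat -> R) : {poly R} := \poly_(i < n.+1) f i.
have truncE f i : (i <= n)%N -> (trunc f)`_i = f i by rewrite coef_poly ltnS => ->.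
have coefMS f (p : {poly R}) i : (i <= n)%N ->
    (trunc (fun k => if k is 0 then 0 else f k) * p)`_i =
    \sum_(1 <= k < i.+1) f k * p`_(i - k).
  move=> le_in; rewrite coefM big_ord_recl truncE //= mul0r add0r big_add1 big_mkord.
  by apply: eq_bigr => j _; rewrite truncE // (leq_trans _ le_in).
have log_deriv f g : (forall m, g m *+ m = \sum_(1 <= k < m.+1) f k * g (m - k)%N) ->
    forall i, (i <= n)%N -> ('X * (trunc g)^`())`_i =
      (trunc (fun k => if k is 0 then 0 else f k) * trunc g)`_i.
  move=> hg i le_in; rewrite coefMS // coefXM.
  rewrite (_ : (if _ then _ else _) = g i *+ i); last first.
    by case: i le_in => // i le_in; rewrite /= coef_deriv truncE.
  rewrite hg big_nat [RHS]big_nat; apply: eq_bigr => k _.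
  by rewrite truncE // (leq_trans (leq_subr _ _)).
have cE m : (m <= n)%N -> c m = (trunc a * trunc b)`_m.
  move=> mn; rewrite coefM; apply: eq_bigr => i _.
  by rewrite !truncE // ?(leq_trans (leq_subr _ _)) // (leq_trans _ mn) // -ltnS.
have coefM_eq (p p' r : {poly R}) : (forall i, (i <= n)%N -> p`_i = p'`_i) ->
    (p * r)`_n = (p' * r)`_n.
  by move=> e; rewrite !coefM; apply: eq_bigr => i _; rewrite e // -ltnS.
transitivity (('X * (trunc a * trunc b)^`())`_n).
  rewrite coefXM cE //; case: (n) => [|m] /=; first by rewrite mulr0n.
  by rewrite coef_deriv.
rewrite derivM mulrDr coefD mulrA (coefM_eq _ _ _ (log_deriv _ _ ha)).
rewrite mulrCA [_ * ('X * _)]mulrC (coefM_eq _ _ _ (log_deriv _ _ hb)).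
rewrite -!mulrA [trunc b * trunc a]mulrC !coefMS // -big_split /=.
rewrite big_nat [RHS]big_nat; apply: eq_bigr => k _.
by rewrite cE ?leq_subr // mulrDl.
Qed.

(** * The valuation of C_p and the field Q_p *)

Section Valuation.
Local Open Scope classical_set_scope.
Variables (R : realType) (C : closedFieldType) (p : nat) (ord : C -> \bar R).
Hypotheses (pr_p : prime p) (hC : is_Cp p ord).
Implicit Types (x y : C) (A B : R).

Let hv := Cp_valuation hC.

(** Real lower bounds keep the infinite value out of the arithmetic and treat 0 like any other
    element. *)
Definition ord_ge A x := (A%:E <= ord x)%E.
Local Notation vge := ord_ge.

Lemma ord0 : ord 0 = +oo%E. Proof. exact/(ord_eqy hv). Qed.

Lemma vge0 A : vge A 0. Proof. by rewrite /ord_ge ord0 leey. Qed.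

Lemma ord_fin x : x != 0 -> exists r, ord x = r%:E.
Proof.
move=> x0; case E : (ord x) => [r| |]; first by exists r.
  by move/(ord_eqy hv): E => E; rewrite E eqxx in x0.
by case: (ord_neqNy hv E).
Qed.

Lemma ordMr x y r s : ord x = r%:E -> ord y = s%:E -> ord (x * y) = (r + s)%:E.
Proof. by rewrite (ordM hv) => -> ->. Qed.

Lemma ord1 : ord 1 = 0%:E.
Proof.
have [r r1] := ord_fin (oner_neq0 C); have := ordMr r1 r1; rewrite mulr1 r1.
by case=> rr; congr (_%:E); lra.
Qed.

Lemma ordN1 : ord (- 1) = 0%:E.
Proof.
have [r r1] : exists r, ord (- 1) = r%:E by apply: ord_fin; rewrite oppr_eq0 oner_eq0.
have := ordMr r1 r1; rewrite mulrNN mulr1 ord1 r1.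
by case=> rr; congr (_%:E); lra.
Qed.

Lemma ordN x : ord (- x) = ord x.
Proof. by rewrite -mulN1r (ordM hv) ordN1 add0e. Qed.

Lemma vgeN A x : vge A (- x) = vge A x. Proof. by rewrite /ord_ge ordN. Qed.

Lemma vgeD A x y : vge A x -> vge A y -> vge A (x + y).
Proof.
by rewrite /ord_ge => hx hy; apply: le_trans (ordD hv x y); rewrite le_min hx.
Qed.

Lemma vgeB A x y : vge A x -> vge A y -> vge A (x - y).
Proof. by move=> hx hy; rewrite vgeD ?vgeN. Qed.

Lemma vge_le A B x : A <= B -> vge B x -> vge A x.
Proof. by rewrite /ord_ge => AB; apply: le_trans; rewrite lee_fin. Qed.

Lemma vgeM A B x y : vge A x -> vge B y -> vge (A + B) (x * y).
Proof. by rewrite /ord_ge (ordM hv) EFinD; apply: leeD. Qed.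

Lemma vge0M x y : vge 0 x -> vge 0 y -> vge 0 (x * y).
Proof. by move=> hx hy; have := vgeM hx hy; rewrite addr0. Qed.

Lemma vgeMl A x y : vge 0 x -> vge A y -> vge A (x * y).
Proof. by move=> hx hy; have := vgeM hx hy; rewrite add0r. Qed.

Lemma vgeMr A x y : vge A x -> vge 0 y -> vge A (x * y).
Proof. by rewrite mulrC => hx hy; apply: vgeMl. Qed.

Lemma vge_sum A (I : Type) (r : seq I) (P : pred I) (f : I -> C) :
  (forall i, P i -> vge A (f i)) -> vge A (\sum_(i <- r | P i) f i).
Proof. by move=> h; apply: (big_ind (vge A)) => //; [exact: vge0|exact: vgeD]. Qed.

Lemma vge01 : vge 0 1. Proof. by rewrite /ord_ge ord1. Qed.

Lemma vge0_nat n : vge 0 n%:R.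
Proof. by elim: n => [|n IH]; [exact: vge0|rewrite -natr1 vgeD ?vge01]. Qed.

Lemma vge0_int (z : int) : vge 0 z%:~R.
Proof. by case: z => n; rewrite ?NegzE ?rmorphN ?vgeN; exact: vge0_nat. Qed.

Lemma vge0X x n : vge 0 x -> vge 0 (x ^+ n).
Proof. by move=> hx; elim: n => [|n IH]; rewrite ?vge01 // exprS vge0M. Qed.

Lemma vgeX A x n : vge A x -> vge (A *+ n) (x ^+ n).
Proof.
by move=> hx; elim: n => [|n IH]; rewrite ?mulr0n ?vge01 // exprS mulrS vgeM.
Qed.

Lemma ordX x r n : ord x = r%:E -> ord (x ^+ n) = (r *+ n)%:E.
Proof.
move=> hx; elim: n => [|n IH]; first by rewrite expr0 mulr0n ord1.
by rewrite exprS mulrS; apply: ordMr.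
Qed.

Lemma ordV x r : ord x = r%:E -> ord x^-1 = (- r)%:E.
Proof.
move=> hx; have x0 : x != 0.
  by apply/eqP => x0; rewrite x0 ord0 in hx.
have [s hs] : exists s, ord x^-1 = s%:E by apply: ord_fin; rewrite invr_eq0.
have := ordMr hx hs; rewrite mulfV // ord1 => -[rs]; rewrite hs; congr (_%:E); lra.
Qed.

Lemma vge_p : vge 1 p%:R. Proof. by rewrite /ord_ge (Cp_ord_p hC). Qed.

Lemma vge_inf x : (forall A, vge A x) -> x = 0.
Proof.
move=> h; apply/eqP; apply: contraT => /ord_fin[r hr].
by have := h (r + 1); rewrite /ord_ge hr lee_fin; lra.
Qed.

Lemma vge_lb x : exists2 B, B <= 0 & vge B x.
Proof.
have [->|/ord_fin[r hr]] := eqVneq x 0; first by exists 0 => //; exact: vge0.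
by exists (Num.min r 0); rewrite ?ge_min ?lexx ?orbT // /ord_ge hr lee_fin ge_min lexx.
Qed.

Lemma vgt0P x : reflect (exists2 e, 0 < e & vge e x) (0 < ord x)%E.
Proof.
apply: (iffP idP) => [|[e e0 h]]; last by apply: lt_le_trans h; rewrite lte_fin.
have [->|/ord_fin[r hr]] := eqVneq x 0; first by exists 1 => //; exact: vge0.
by rewrite hr lte_fin => r0; exists r => //; rewrite /ord_ge hr.
Qed.

Lemma vge1_vgt0 x : vge 1 x -> (0 < ord x)%E.
Proof. by move=> h; apply/vgt0P; exists 1. Qed.

Lemma vgt0D x y : (0 < ord x)%E -> (0 < ord y)%E -> (0 < ord (x + y))%E.
Proof. by move=> hx hy; apply: lt_le_trans (ordD hv x y); rewrite lt_min hx. Qed.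

Lemma vgt0N x : (0 < ord (- x))%E = (0 < ord x)%E. Proof. by rewrite ordN. Qed.

Lemma vgt0Ml x y : vge 0 x -> (0 < ord y)%E -> (0 < ord (x * y))%E.
Proof. by move=> hx /vgt0P[e e0 hy]; apply/vgt0P; exists e => //; apply: vgeMl. Qed.

Lemma vgt0_sum (I : Type) (r : seq I) (P : pred I) (f : I -> C) :
  (forall i, P i -> (0 < ord (f i))%E) -> (0 < ord (\sum_(i <- r | P i) f i))%E.
Proof.
move=> h; apply: (big_ind (fun x => (0 < ord x)%E)) => //; first by rewrite ord0 ltry.
exact: vgt0D.
Qed.

Lemma vgt01 : ~~ (0 < ord 1)%E. Proof. by rewrite ord1 ltxx. Qed.

(** Otherwise a Bezout relation between n and p would give 1 a positive valuation. *)
Lemma vgt0_nat n : (0 < ord n%:R)%E -> (p %| n)%N.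
Proof.
move=> hn; apply: contraT => pn.
have cpn : coprime n p by rewrite coprime_sym prime_coprime.
have n0 : (0 < n)%N by rewrite lt0n; apply: contra pn => /eqP ->; rewrite dvdn0.
case: (egcdnP p n0) => a b; rewrite (eqP cpn) => e _.
have : (0 < ord (a%:R * n%:R - b%:R * p%:R))%E.
  rewrite vgt0D ?vgt0N ?vgt0Ml ?vge0_nat //; exact/vge1_vgt0/vge_p.
by rewrite -!natrM e natrD addrC addKr (negbTE vgt01).
Qed.

Lemma vge1_natP n : reflect (vge 1 n%:R) (p %| n)%N.
Proof.
apply: (iffP idP) => [/dvdnP[m ->]|/vge1_vgt0]; last exact: vgt0_nat.
by rewrite natrM vgeMl ?vge0_nat ?vge_p.
Qed.

Lemma ord_unit_nat n : ~~ (p %| n)%N -> ord n%:R = 0%:E.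
Proof.
move=> pn; apply/eqP; rewrite eq_le; apply/andP; split; last exact: vge0_nat.
by rewrite leNgt; apply: contra pn; exact: vgt0_nat.
Qed.

Lemma Cp_char0 n : (0 < n)%N -> n%:R != 0 :> C.
Proof.
move=> n0; have [m cpm ->] := pfactor_coprime pr_p n0.
apply/eqP => e; have := ord0; rewrite -e natrM natrX.
rewrite (ordMr (ord_unit_nat _) (ordX _ (Cp_ord_p hC))) //.
by rewrite -prime_coprime.
Qed.

Lemma vge0_nat_diff m n : vge 1 (m%:R - n%:R) -> m = n %[mod p].
Proof.
wlog le_nm : m n / (n <= m)%N => [th h|].
  have [/th|/ltnW/th] := leqP n m; first exact.
  by rewrite -opprB vgeN in h; move/(_ h).
by rewrite -natrB // => /vge1_natP; rewrite -eqn_mod_dvd // => /eqP.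
Qed.

Local Notation Qp := (Qp ord).

Lemma Qp_rat r : Qp (ratr r). Proof. by move=> A; exists r; rewrite subrr -/(vge _ _) vge0. Qed.

Lemma Qp_nat n : Qp n%:R. Proof. by rewrite -(ratr_nat _ n); exact: Qp_rat. Qed.

Lemma Cp_int_neq0 (z : int) : z != 0 -> z%:~R != 0 :> C.
Proof.
case: z => [n|n _]; first by rewrite eqz_nat -lt0n => /Cp_char0.
by rewrite NegzE rmorphN oppr_eq0; exact: (@Cp_char0 n.+1).
Qed.

Lemma ratr_frac_Cp (a b : int) : b != 0 -> ratr (a%:~R / b%:~R) = a%:~R / b%:~R :> C.
Proof.
move=> b0; rewrite /ratr; set r : rat := _ / _.
apply/eqP; rewrite eqr_div ?Cp_int_neq0 ?denq_neq0 // -!intrM; apply/eqP; congr (_%:~R).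
have : (numq r)%:~R / (denq r)%:~R = a%:~R / b%:~R :> rat by rewrite divq_num_den.
move/eqP; rewrite eqr_div ?intr_eq0 ?denq_neq0 // -!intrM => /eqP/intr_inj -> //.
Qed.

Lemma ratrB_Cp (r s : rat) : ratr (r - s) = ratr r - ratr s :> C.
Proof.
rewrite -{1}(divq_num_den r) -{1}(divq_num_den s) -mulNr addf_div ?intr_eq0 ?denq_neq0 //.
rewrite -rmorphN -!rmorphM -rmorphD ratr_frac_Cp ?mulf_neq0 ?denq_neq0 //.
by rewrite /ratr rmorphD !rmorphM rmorphN -mulNr [RHS]addf_div ?Cp_int_neq0 ?denq_neq0.
Qed.

Lemma ratrM_Cp (r s : rat) : ratr (r * s) = ratr r * ratr s :> C.
Proof.
rewrite -{1}(divq_num_den r) -{1}(divq_num_den s) mulf_div -!rmorphM.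
by rewrite ratr_frac_Cp ?mulf_neq0 ?denq_neq0 // /ratr !rmorphM mulf_div.
Qed.

Lemma ratrV_Cp (r : rat) : ratr r^-1 = (ratr r)^-1 :> C.
Proof.
have [->|r0] := eqVneq r 0; first by rewrite invr0 (ratr_nat _ 0) invr0.
by rewrite -{1}(divq_num_den r) invf_div ratr_frac_Cp ?numq_eq0 // /ratr invf_div.
Qed.

Lemma QpB x y : Qp x -> Qp y -> Qp (x - y).
Proof.
move=> hx hy A; have [r hr] := hx A; have [s hs] := hy A.
exists (r - s); rewrite ratrB_Cp -/(vge _ _).
have -> : x - y - (ratr r - ratr s) = (x - ratr r) - (y - ratr s) by ring.
exact: vgeB.
Qed.

Lemma QpM x y : Qp x -> Qp y -> Qp (x * y).
Proof.
move=> hx hy A; have [B B0 hB] := vge_lb x; have [D D0 hD] := vge_lb y.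
(* Replacing A by its maximum with 0 makes the product of the two errors small enough as well. *)
have [r hr] := hx (Num.max A 0 - D); have [s hs] := hy (Num.max A 0 - B).
have A0 : 0 <= Num.max A 0 by rewrite le_max lexx orbT.
have AA : A <= Num.max A 0 by rewrite le_max lexx.
exists (r * s); rewrite ratrM_Cp -/(vge _ _).
have -> : x * y - ratr r * ratr s =
  y * (x - ratr r) + (x * (y - ratr s) - (x - ratr r) * (y - ratr s)) by ring.
apply: (vge_le AA); apply: vgeD; first by apply: vge_le (vgeM hD hr); lra.
apply: vgeB; first by apply: vge_le (vgeM hB hs); lra.
by apply: vge_le (vgeM hr hs); lra.
Qed.

Lemma ord_close x y r : ord x = r%:E -> (r%:E < ord (x - y))%E -> ord y = r%:E.
Proof.
move=> hx hxy; have yE : y = x - (x - y) by ring.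
have xE : x = y + (x - y) by ring.
apply/eqP; rewrite eq_le; apply/andP; split; last first.
  by rewrite {1}yE -/(vge _ _) vgeB // /ord_ge ?hx // ltW.
rewrite leNgt; apply/negP => hy.
have := ordD hv y (x - y); rewrite -xE hx leNgt => /negP; apply.
by rewrite lt_min hy.
Qed.

Lemma QpV x : Qp x -> Qp x^-1.
Proof.
move=> hx; have [->|x0] := eqVneq x 0; first by rewrite invr0; exact: (Qp_nat 0).
have [s hs] := ord_fin x0; move=> A.
(* Inversion costs twice the valuation s of x; the bound s + 1 forces the approximation to have
   valuation s too. *)
have [r hr] := hx (Num.max (A + s + s) (s + 1)).
have hrs : ord (ratr r) = s%:E.
  apply: (ord_close hs); apply: lt_le_trans hr.
  by rewrite lte_fin lt_max; apply/orP; right; lra.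
have r0 : ratr r != 0 :> C by apply/eqP => r0; rewrite r0 ord0 in hrs.
exists r^-1; rewrite ratrV_Cp -/(vge _ _).
have -> : x^-1 - (ratr r)^-1 = - ((x - ratr r) * (x^-1 * (ratr r)^-1)).
  by field; rewrite x0 r0.
rewrite vgeN; have h1 : vge (- s - s) (x^-1 * (ratr r)^-1).
  by rewrite /ord_ge (ordMr (ordV hs) (ordV hrs)).
apply: vge_le (vgeM hr h1).
have : A + s + s <= Num.max (A + s + s) (s + 1) by rewrite le_max lexx.
lra.
Qed.

Lemma Qp_subfield : is_subfield Qp.
Proof.
split; [exact: (Qp_nat 1)|exact: QpB|exact: QpM|exact: QpV].
Qed.

(** A rational approximation of c is integral, so its denominator is prime to p and can be inverted
    modulo p. *)
Lemma Qp_integral_nat c : Qp c -> vge 0 c -> exists n, vge 1 (c - n%:R).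
Proof.
move=> hc c0; have [r hr] := hc 1.
have r0 : vge 0 (ratr r).
  have -> : ratr r = c - (c - ratr r) by ring.
  by apply: vgeB => //; apply: vge_le hr.
have [z zE] : exists z : int, numq r = z by exists (numq r).
have [d dE] : exists d : nat, denq r = d by case: (denq r) (denq_gt0 r) => // d _; exists d.
have pd : ~~ (p %| d)%N.
  apply/negP => pd; have d0 : d%:R != 0 :> C.
    by apply: Cp_char0; have := denq_gt0 r; rewrite dE.
  have zr : z%:~R = d%:R * ratr r :> C by rewrite /ratr zE dE mulrC divfK.
  have : (0 < ord `|z|%N%:R)%E.
    have : (0 < ord z%:~R)%E by rewrite zr mulrC vgt0Ml //; exact/vge1_vgt0/vge1_natP.
    by case: (z) => n; rewrite ?NegzE ?rmorphN ?ordN.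
  move=> /vgt0_nat pz; have := coprime_num_den r; rewrite zE dE /= => /eqP g1.
  by have := dvdn_gcd p `|z| d; rewrite g1 pz pd dvdn1 gtn_eqF // prime_gt1.
have cpd : coprime d p by rewrite coprime_sym prime_coprime.
have d_gt0 : (0 < d)%N by have := denq_gt0 r; rewrite dE.
case: (egcdnP p d_gt0) => a b; rewrite (eqP cpd) => e _.
pose n := `|((z * a) %% p)%Z|%N.
have nE : n = ((z * a) %% p)%Z :> int.
  by rewrite /n gez0_abs // modz_ge0 // -lt0n prime_gt0.
exists n.
have -> : c - n%:R = (c - ratr r) + (ratr r - n%:R) by ring.
apply: vgeD => //.
have -> : ratr r - n%:R = (z%:~R - n%:R * d%:R) * d%:R^-1 :> C.
  rewrite /ratr zE dE; field; exact: Cp_char0.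
apply: vgeMr; last by rewrite /ord_ge (ordV (ord_unit_nat pd)) oppr0.
have -> : z%:~R - n%:R * d%:R = (z - n%:Z * d)%:~R :> C by rewrite rmorphB rmorphM.
have /dvdzP[m ->] : (p %| (z - n%:Z * d))%Z.
  rewrite nE -eqz_mod_dvd modzMml -mulrA -PoszM e.
  by rewrite PoszD PoszM mulrDr mulrA modzMDl mulr1.
by rewrite rmorphM vgeMl ?vge0_int //; exact: vge_p.
Qed.

Lemma Qp_closed (u : nat -> C) l : (forall n, Qp (u n)) -> ord_cvg ord u l -> Qp l.
Proof.
move=> hu ul A; have [N hN] := ul A; have [r hr] := hu N A.
exists r; have -> : l - ratr r = (u N - ratr r) - (u N - l) by ring.
exact: vgeB (hN _ (leqnn _)).
Qed.

End Valuation.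

(** * Linear algebra over a subfield *)

Section SubfieldType.
Local Open Scope classical_set_scope.
Variables (C : fieldType) (k : set C) (hk : is_subfield k).

Definition subfield_pred of is_subfield k : {pred C} := [pred x | `[< k x >]].
Local Notation kP := (subfield_pred hk).

Fact subfield_divring : divring_closed kP.
Proof.
split; first by apply/asboolP; exact: subfield1 hk.
- by move=> x y /asboolP hx /asboolP hy; apply/asboolP/(subfieldB hk).
- move=> x y /asboolP hx /asboolP hy; apply/asboolP/(subfieldM hk) => //.
  exact: (subfieldV hk).
Qed.

HB.instance Definition _ := GRing.isDivringClosed.Build C kP subfield_divring.

(** The set [k] as a field type, which gives access to determinants and inverse matrices over
    [k]. *)
Record subfield_type := SubfieldElt { subfield_val : C; _ : subfield_val \in kP }.

HB.instance Definition _ := [isSub for subfield_val].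
HB.instance Definition _ := [Choice of subfield_type by <:].
HB.instance Definition _ := [SubChoice_isSubIntegralDomain of subfield_type by <:].
HB.instance Definition _ := [SubIntegralDomain_isSubField of subfield_type by <:].

Lemma subfield_valP (x : subfield_type) : k (val x).
Proof. by case: x => x /= /asboolP. Qed.

Lemma subfield_lift x : k x -> exists y : subfield_type, val y = x.
Proof. by move=> /asboolP hx; exists (SubfieldElt (hx : x \in kP)). Qed.

Lemma subfield_lift_mx m n (A : 'M[C]_(m, n)) : (forall i j, k (A i j)) ->
  exists B : 'M[subfield_type]_(m, n), A = map_mx val B.
Proof.
move=> hA; have /boolp.choice[f fE] : forall ij : 'I_m * 'I_n, exists y : subfield_type,
    val y = A ij.1 ij.2.
  by move=> ij; apply/subfield_lift.
by exists (\matrix_(i, j) f (i, j)); apply/matrixP => i j; rewrite !mxE fE.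
Qed.

End SubfieldType.

(** * Bases over a subfield, and independence of the trace from the basis *)

Section Bases.
Local Open Scope classical_set_scope.

(** The square matrix over [k] that expresses [w] in [b] is invertible, since a kernel vector would
    be a relation in [w]; so [b], and with it [K], lies in the span of [w]. *)
Lemma free_family_basis (C : fieldType) (k K : set C) m (b w : 'rV[C]_m) :
  is_subfield k -> is_basis k K b ->
  (forall i, K (w 0 i)) ->
  (forall c : 'I_m -> C, (forall i, k (c i)) ->
     \sum_(i < m) c i * w 0 i = 0 -> forall i, c i = 0) ->
  is_basis k K w.
Proof.
move=> hk [bK bspan bfree] wK wfree; split=> // x xK.
have [P PE] : exists P : 'M[C]_m, (forall i j, k (P i j)) /\ w = b *m P.
  have /boolp.choice[c cP] : forall j, exists c : 'I_m -> C, (forall i, k (c i)) /\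
      w 0 j = \sum_(i < m) c i * b 0 i.
    by move=> j; have [c c1 c2] := bspan _ (wK j); exists c.
  exists (\matrix_(i, j) c j i); split=> [i j|]; first by rewrite mxE; have [] := cP j.
  apply/rowP => j; rewrite mxE; have [_ ->] := cP j; apply: eq_bigr => i _.
  by rewrite mxE mulrC.
have [kP wE] := PE; have [P0 P0E] := subfield_lift_mx hk kP.
have uP0 : P0 \in unitmx.
  rewrite unitmxE unitfE; apply/negP => /eqP.
  rewrite -det_tr => /eqP/det0P[v v0 vP].
  have hc i : k (val (v 0 i)) by exact: subfield_valP.
  have : \sum_(i < m) val (v 0 i) * w 0 i = 0.
    transitivity ((w *m map_mx val v^T) 0 0).
      by rewrite mxE; apply: eq_bigr => i _; rewrite !mxE mulrC.
    rewrite wE P0E -mulmxA -map_mxM -[P0]trmxK -trmx_mul vP.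
    by rewrite trmx0 map_mx0 mulmx0 mxE.
  move=> /(wfree _ hc) vi; case/eqP: v0; apply/rowP => i; rewrite mxE.
  by apply: val_inj; rewrite vi rmorph0.
have [d dk xE] := bspan _ xK.
pose D : 'cV[C]_m := \col_i d i.
have wb : b = w *m map_mx val (invmx P0).
  by rewrite wE P0E -mulmxA -map_mxM mulmxV // map_mx1 mulmx1.
have [D0 D0E] := @subfield_lift_mx _ _ hk _ _ D (fun i j => ltac:(rewrite mxE; exact: dk)).
exists (fun i => val ((invmx P0 *m D0) i 0)); first by move=> i; exact: subfield_valP.
transitivity ((b *m D) 0 0).
  by rewrite xE mxE; apply: eq_bigr => i _; rewrite mxE mulrC.
rewrite wb D0E -mulmxA -map_mxM mxE; apply: eq_bigr => i _.
by rewrite mxE mulrC.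
Qed.

(** [trace] chooses a basis of a size not known in advance, so the change of basis matrices are
    rectangular. Freeness makes them inverse to each other and makes them intertwine [M] and [N]. *)
Lemma trace_basis_indep (C : fieldType) (k K : set C) m n (b : 'rV[C]_m) (w : 'rV[C]_n)
    (M : 'M[C]_m) (N : 'M[C]_n) x :
  is_subfield k -> is_basis k K b -> is_basis k K w ->
  (forall i j, k (M i j)) -> (forall i j, k (N i j)) ->
  x *: b = b *m M -> x *: w = w *m N -> \tr M = \tr N.
Proof.
move=> hk hb hw kM kN xb xw.
have k0 : k 0 by rewrite -(subrr 1); apply: (subfieldB hk); exact: (subfield1 hk).
have kD y z : k y -> k z -> k (y + z).
  move=> ky kz; rewrite -[z]opprK -[- z]sub0r.
  by apply: (subfieldB hk) => //; apply: (subfieldB hk).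
have kmul m1 n1 p1 (A : 'M[C]_(m1, n1)) (B : 'M[C]_(n1, p1)) :
    (forall i j, k (A i j)) -> (forall i j, k (B i j)) -> forall i j, k ((A *m B) i j).
  move=> kA kB i j; rewrite mxE; apply: (big_ind k) => // l _.
  exact: (subfieldM hk).
have expand m1 n1 (a : 'rV[C]_m1) (c : 'rV[C]_n1) : is_basis k K a -> is_basis k K c ->
    exists2 P : 'M[C]_(m1, n1), (forall i j, k (P i j)) & c = a *m P.
  move=> [_ aspan _] [cK _ _].
  have /boolp.choice[f fP] : forall j, exists f : 'I_m1 -> C, (forall i, k (f i)) /\
      c 0 j = \sum_(i < m1) f i * a 0 i.
    by move=> j; have [d d1 d2] := aspan _ (cK j); exists d.
  exists (\matrix_(i, j) f j i) => [i j|]; first by rewrite mxE; have [] := fP j.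
  apply/rowP => j; rewrite mxE; have [_ ->] := fP j; apply: eq_bigr => i _.
  by rewrite mxE mulrC.
have cancel m1 n1 (a : 'rV[C]_m1) (A B : 'M[C]_(m1, n1)) : is_basis k K a ->
    (forall i j, k (A i j)) -> (forall i j, k (B i j)) -> a *m A = a *m B -> A = B.
  move=> [_ _ afree] kA kB /eqP; rewrite -subr_eq0 -mulmxBr => /eqP e.
  apply/matrixP => i j; apply/eqP; rewrite -subr_eq0; apply/eqP.
  have := congr1 (fun Z : 'rV[C]_n1 => Z 0 j) e; rewrite !mxE => ej.
  apply: (afree (fun i => A i j - B i j)) => [i'|]; first exact: (subfieldB hk).
  by rewrite -[RHS]ej; apply: eq_bigr => l _; rewrite !mxE mulrC.
have [P kP wE] := expand _ _ _ _ hb hw; have [P' kP' bE] := expand _ _ _ _ hw hb.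
have k1 m1 i j : k ((1%:M : 'M[C]_m1) i j).
  by rewrite mxE; case: (_ == _); [exact: (subfield1 hk)|].
have PP' : P *m P' = 1%:M.
  by apply: (cancel _ _ b) => //; [exact: kmul|rewrite mulmxA -wE -bE mulmx1].
have MP : M *m P = P *m N.
  apply: (cancel _ _ b) => //; try exact: kmul.
  by rewrite !mulmxA -xb -wE -xw -scalemxAl -wE.
by rewrite -[M]mulmx1 -PP' mulmxA MP -mulmxA mxtrace_mulC -mulmxA
  (_ : P' *m P = 1%:M) ?mulmx1 //; apply: (cancel _ _ w) => //;
  [exact: kmul|rewrite mulmxA -bE -wE mulmx1].
Qed.

End Bases.

(** * The residue trace *)

Section FiniteField.
Local Open Scope classical_set_scope.
Variables (F : finFieldType) (p m : nat).
Hypotheses (pr_p : prime p) (card_F : #|F| = (p ^ m)%N).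

Lemma finField_pchar : p \in [pchar F].
Proof. exact: card_finPcharP card_F pr_p. Qed.

(** Coordinates are natural numbers, to be read modulo p, so that the same combinations make sense
    in [C] and are respected by reduction. *)
Lemma prime_field_basis : exists e : 'I_m -> F,
  (forall x, exists c : 'I_m -> nat, x = \sum_i (c i)%:R * e i) /\
  (forall c : 'I_m -> nat, \sum_i (c i)%:R * e i = 0 -> forall i, (p %| c i)%N).
Proof.
have chp := finField_pchar; pose V : vectType 'F_p := pPrimeCharType chp.
have dimV : \dim {: V} = m.
  by rewrite dimvf /dim /= card_F pfactorK.
have [X bX] : exists X : m.-tuple V, basis_of fullv X.
  by rewrite -dimV; exists (vbasis fullv); exact: vbasisP.
exists (fun i => X`_i); split=> [x|c h i].
  exists (fun i => coord X i (x : V) : nat).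
  have /(coord_basis bX) xE : (x : V) \in fullv by exact: memvf.
  by rewrite [LHS]xE.
have fX : free X by apply: basis_free bX.
have : \sum_(j < m) ((c j)%:R : 'F_p) *: X`_j = 0.
  rewrite -[RHS]h; apply: eq_bigr => j _.
  change (((c j)%:R : 'F_p) *: X`_j) with (((c j)%:R : 'F_p)%:R * (X`_j : F)).
  congr (_ * _); rewrite val_Fp_nat // [in RHS](divn_eq (c j) p) natrD natrM.
  by rewrite (pcharf0 chp) mulr0 add0r.
move/freeP: fX => fX /fX /(_ i) /eqP.
by rewrite -(dvdn_pcharf (pchar_Fp pr_p)).
Qed.

Lemma sum_pX (I : Type) (r : seq I) (f : I -> F) i :
  (\sum_(j <- r) f j) ^+ (p ^ i) = \sum_(j <- r) f j ^+ (p ^ i).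
Proof.
apply: (big_morph (fun x : F => x ^+ (p ^ i))) => [x y|].
  by rewrite exprDn_pchar // pnatX pnatE ?finField_pchar.
by rewrite expr0n gtn_eqF // expn_gt0 prime_gt0.
Qed.

Lemma nat_pX n i : (n%:R : F) ^+ (p ^ i) = n%:R.
Proof.
elim: i => [|i IH]; first by rewrite expr1.
rewrite expnS exprM -[_ ^+ p](pFrobenius_autE finField_pchar).
by rewrite pFrobenius_aut_nat.
Qed.

(* Conjugating by the Moore matrix [e_j ^ (p ^ i)] diagonalises multiplication by x. *)
Lemma residue_trace (e : 'rV[F]_m) (x : F) (N : 'I_m -> 'I_m -> nat) :
  (0 < m)%N ->
  (forall y, exists c : 'I_m -> nat, y = \sum_i (c i)%:R * e 0 i) ->
  (forall j, x * e 0 j = \sum_i e 0 i * (N i j)%:R) ->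
  \sum_i (N i i)%:R = \sum_(i < m) x ^+ (p ^ i).
Proof.
move=> m_gt0 espan xe.
pose M : 'M[F]_m := \matrix_(i, j) (N i j)%:R.
pose W : 'M[F]_m := \matrix_(i, j) (e 0 j) ^+ (p ^ i).
pose D : 'M[F]_m := diag_mx (\row_i x ^+ (p ^ i)).
have DW : D *m W = W *m M.
  apply/matrixP => i j; rewrite mul_diag_mx !mxE -exprMn xe sum_pX.
  by apply: eq_bigr => l _; rewrite !mxE exprMn nat_pX.
(* A row a killed by [W] gives the nonzero polynomial sum_i a_i X^(p^i), of degree at most p^(m-1),
   which vanishes at all p^m elements. *)
have uW : W \in unitmx.
  rewrite unitmxE unitfE; apply/negP => /det0P[a a0 aW].
  pose P : {poly F} := \sum_i a 0 i *: 'X^(p ^ i).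
  have P0 : P != 0.
    apply: contra a0 => /eqP P0; apply/eqP/rowP => i; rewrite mxE.
    have := congr1 (fun q : {poly F} => q`_(p ^ i)) P0; rewrite coef0 coef_sum.
    rewrite (bigD1 i) //= coefZ coefXn eqxx mulr1 big1 ?addr0 // => j ji.
    by rewrite coefZ coefXn eqn_exp2l ?prime_gt1 // eq_sym (inj_eq val_inj) (negbTE ji) mulr0.
  have rP y : root P y.
    have [c ->] := espan y; rewrite rootE horner_sum; apply/eqP.
    transitivity (\sum_i (c i)%:R * (a *m W) 0 i); last first.
      by rewrite aW big1 // => i _; rewrite mxE mulr0.
    under [RHS]eq_bigr do rewrite mxE mulr_sumr.
    rewrite exchange_big /=; apply: eq_bigr => i _; rewrite hornerZ hornerXn sum_pX mulr_sumr.
    by apply: eq_bigr => j _; rewrite exprMn nat_pX mxE mulrCA.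
  have := max_poly_roots P0 (introT allP (fun y _ => rP y)) (enum_uniq F).
  rewrite -cardE card_F leqNgt ltnS; case/negP.
  apply: leq_trans (size_sum _ _ _) _; apply/bigmax_leqP => i _.
  rewrite (leq_trans (size_scale_leq _ _)) // size_polyXn.
  by rewrite ltn_exp2l ?prime_gt1.
have -> : \sum_i (N i i)%:R = \tr M by apply: eq_bigr => i _; rewrite mxE.
have -> : M = invmx W *m (D *m W) by rewrite DW mulmxA mulVmx // mul1mx.
rewrite mxtrace_mulC -mulmxA mulmxV // mulmx1 mxtrace_diag.
by apply: eq_bigr => i _; rewrite mxE.
Qed.

End FiniteField.

(** * Unramified extensions *)

Section Unramified.
Local Open Scope classical_set_scope.
Variables (R : realType) (C : closedFieldType) (p : nat) (ord : C -> \bar R).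
Hypotheses (pr_p : prime p) (hC : is_Cp p ord).
Variables (K : local_ext C) (m : nat).
Hypotheses (m_gt0 : (0 < m)%N) (hK : is_unramified p ord m K).

Local Notation vge := (ord_ge ord).
Local Notation Qp := (Qp ord).
Local Notation KK := (ext_carrier K).
Local Notation OK := (integers ord K).
Local Notation F := (resfield K).
Local Notation red := (Defs.red K).
Local Notation q := #|F|.

Let hred := unram_reduction hK.
Let card_F : q = (p ^ m)%N := unram_resdegree hK.

Lemma ext_subfield : is_subfield KK. Proof. by have [] := unram_degree hK. Qed.

Lemma Qp_sub_ext x : Qp x -> KK x. Proof. by have [_ h _] := unram_degree hK; exact: h. Qed.

Lemma ext0 : KK 0. Proof. exact/Qp_sub_ext/(Qp_nat hC 0). Qed.

Lemma extB x y : KK x -> KK y -> KK (x - y). Proof. exact: subfieldB ext_subfield _ _. Qed.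

Lemma extD x y : KK x -> KK y -> KK (x + y).
Proof. by move=> hx hy; rewrite -[y]opprK -[- y]sub0r; do 2?apply: extB => //; exact: ext0. Qed.

Lemma extM x y : KK x -> KK y -> KK (x * y). Proof. exact: subfieldM ext_subfield _ _. Qed.

Lemma ext_sum (I : Type) (r : seq I) (f : I -> C) :
  (forall i, KK (f i)) -> KK (\sum_(i <- r) f i).
Proof. by move=> h; apply: (big_ind KK) => //; [exact: ext0|exact: extD]. Qed.

Lemma int_nat n : OK n%:R.
Proof. by split; [exact: Qp_sub_ext (Qp_nat hC n)|exact: vge0_nat hC n]. Qed.

Lemma intB x y : OK x -> OK y -> OK (x - y).
Proof. by move=> [? ?] [? ?]; split; [exact: extB|exact: (vgeB hC)]. Qed.

Lemma intN x : OK x -> OK (- x).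
Proof. by rewrite -sub0r; apply: intB; exact: (int_nat 0). Qed.

Lemma intD x y : OK x -> OK y -> OK (x + y).
Proof. by move=> hx /intN hy; rewrite -[y]opprK; apply: intB. Qed.

Lemma intM x y : OK x -> OK y -> OK (x * y).
Proof. by move=> [? ?] [? ?]; split; [exact: extM|exact: (vge0M hC)]. Qed.

Lemma intX x n : OK x -> OK (x ^+ n).
Proof.
by move=> hx; elim: n => [|n IH]; [exact: (int_nat 1)|rewrite exprS; exact: intM].
Qed.

Lemma int_sum (I : Type) (r : seq I) (f : I -> C) :
  (forall i, OK (f i)) -> OK (\sum_(i <- r) f i).
Proof. by move=> h; apply: (big_ind OK) => //; [exact: (int_nat 0)|exact: intD]. Qed.

Lemma red0 : red 0 = 0.
Proof. by rewrite -(subrr 1) (redB hred) ?subrr //; exact: (int_nat 1). Qed.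

Lemma redN x : OK x -> red (- x) = - red x.
Proof. by move=> hx; rewrite -sub0r (redB hred) ?red0 ?sub0r //; exact: (int_nat 0). Qed.

Lemma redD x y : OK x -> OK y -> red (x + y) = red x + red y.
Proof.
by move=> hx hy; rewrite -[y]opprK (redB hred) ?redN ?opprK //; exact: intN.
Qed.

Lemma redX x n : OK x -> red (x ^+ n) = red x ^+ n.
Proof.
move=> hx; elim: n => [|n IH]; first exact: red1 hred.
by rewrite !exprS (redM hred) ?IH //; exact: intX.
Qed.

Lemma red_nat n : red n%:R = n%:R.
Proof.
elim: n => [|n IH]; first exact: red0.
by rewrite -!natr1 redD ?IH ?(red1 hred) //; [exact: int_nat|exact: (int_nat 1)].
Qed.

Lemma red_sum (I : Type) (r : seq I) (f : I -> C) :
  (forall i, OK (f i)) -> red (\sum_(i <- r) f i) = \sum_(i <- r) red (f i).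
Proof.
move=> h; suff [] : OK (\sum_(i <- r) f i) /\
  red (\sum_(i <- r) f i) = \sum_(i <- r) red (f i) by [].
elim: r => [|i r [IH1 IH2]]; first by rewrite !big_nil; split; [exact: (int_nat 0)|exact: red0].
by rewrite !big_cons; split; [exact: intD|rewrite redD ?IH2].
Qed.

Lemma red_eq x y : OK x -> OK y -> (0 < ord (x - y))%E -> red x = red y.
Proof.
move=> hx hy h; apply/eqP; rewrite -subr_eq0 -(redB hred) //; apply/eqP.
exact/(red_eq0 hred (intB hx hy)).
Qed.

Lemma red_eq_vgt0 x y : OK x -> OK y -> red x = red y -> (0 < ord (x - y))%E.
Proof.
by move=> hx hy h; apply/(red_eq0 hred (intB hx hy)); rewrite (redB hred) // h subrr.
Qed.

(** Lift a basis of the residue field. Dividing a combination by its coordinate of least valuation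
    makes all coordinates integral and one of them 1; a positive valuation of the result would
    reduce to a nontrivial relation in the residue field. Hence valuations are read on coordinates,
    the lift is free, and having the size of the degree it is a basis. *)
Lemma integral_basis : exists w : 'rV[C]_m,
  [/\ forall i, OK (w 0 i),
      forall c : 'I_m -> nat, \sum_i (c i)%:R * red (w 0 i) = 0 -> forall i, (p %| c i)%N,
      forall x, exists c : 'I_m -> nat, x = \sum_i (c i)%:R * red (w 0 i),
      is_basis Qp KK w &
      forall (c : 'I_m -> C) A, (forall i, Qp (c i)) ->
        vge A (\sum_i c i * w 0 i) -> forall i, vge A (c i)].
Proof.
have [e [espan efree]] := prime_field_basis pr_p card_F.
have /boolp.choice[w' w'P] : forall i, exists x, OK x /\ red x = e i.
  by move=> i; have [x x1 x2] := red_surj hred (e i); exists x.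
pose w : 'rV[C]_m := \row_i w' i.
have wO i : OK (w 0 i) by rewrite mxE; have [] := w'P i.
have we i : red (w 0 i) = e i by rewrite mxE; have [] := w'P i.
have wval (c : 'I_m -> C) A : (forall i, Qp (c i)) ->
    vge A (\sum_i c i * w 0 i) -> forall i, vge A (c i).
  move=> cQ cA; apply/forallP; apply: contraT; rewrite negb_forall => /existsP[i0 hi0].
  have [i1 _ i1min] :=
    @Order.TotalTheory.arg_minP _ (\bar R) 'I_m i0 xpredT (fun i => ord (c i)) isT.
  have hi1 : (ord (c i1) < A%:E)%E.
    by apply: le_lt_trans (i1min i0 isT) _; rewrite ltNge.
  have c1 : c i1 != 0 by apply/eqP => h; rewrite h (ord0 hC) in hi1.
  have [r hr] := ord_fin hC c1; have rA : r < A by rewrite -lte_fin -hr.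
  pose d i := c i / c i1.
  have dQ i : Qp (d i) by apply: (QpM pr_p hC (cQ i)); exact: (QpV pr_p hC (cQ i1)).
  have d0 i : vge 0 (d i).
    have h1 : vge r (c i) by rewrite /ord_ge -hr i1min.
    have h2 : vge (- r) (c i1)^-1 by rewrite /ord_ge (ordV hC hr).
    by have := vgeM hC h1 h2; rewrite subrr.
  have dsum : (0 < ord (\sum_i d i * w 0 i))%E.
    apply/(vgt0P hC); exists (A - r); first by lra.
    have -> : \sum_i d i * w 0 i = (\sum_i c i * w 0 i) * (c i1)^-1.
      by rewrite mulr_suml; apply: eq_bigr => i _; rewrite mulrAC.
    by apply: (vgeM hC) => //; rewrite /ord_ge (ordV hC hr).
  have /boolp.choice[n nP] : forall i, exists n : nat, vge 1 (d i - n%:R).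
    by move=> i; exact: (Qp_integral_nat pr_p hC (dQ i) (d0 i)).
  have nsum : (0 < ord (\sum_i (n i)%:R * w 0 i))%E.
    have -> : \sum_i (n i)%:R * w 0 i =
        \sum_i d i * w 0 i - \sum_i w 0 i * (d i - (n i)%:R).
      by rewrite -sumrB; apply: eq_bigr => i _; ring.
    rewrite (vgt0D hC) ?(vgt0N hC) //; apply: (vgt0_sum hC) => i _.
    apply: (vgt0Ml hC); first by have [] := wO i.
    exact: (vge1_vgt0 hC (nP i)).
  have nw i : OK ((n i)%:R * w 0 i) by apply: intM => //; exact: int_nat.
  have /efree/(_ i1) pn : \sum_i (n i)%:R * e i = 0.
    transitivity (red (\sum_i (n i)%:R * w 0 i)).
      rewrite red_sum //; apply: eq_bigr => i _.
      by rewrite (redM hred) ?red_nat ?we //; exact: int_nat.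
    by apply/(red_eq0 hred) => //; exact: int_sum.
  (* The coordinate at [i1] is 1, while p divides the integer approximating it. *)
  have := nP i1; rewrite /d divff // => h1.
  have : vge 1 1.
    have -> : 1 = (1 - (n i1)%:R) + (n i1)%:R :> C by ring.
    by apply: (vgeD hC) => //; exact/(vge1_natP pr_p hC).
  by move=> /(vge1_vgt0 hC); rewrite (negbTE (vgt01 hC)).
exists w; split=> //.
- by move=> c h; apply: efree; rewrite -[RHS]h; apply: eq_bigr => i _; rewrite we.
- by move=> x; have [c ->] := espan x; exists c; apply: eq_bigr => i _; rewrite we.
have [_ _ [b hb]] := unram_degree hK.
apply: (free_family_basis (Qp_subfield pr_p hC) hb) => //.
- by move=> i; have [] := wO i.
- move=> c cQ c0 i; apply: (vge_inf hC) => A.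
  by apply: (wval c) => //; rewrite c0 (vge0 hC).
Qed.

(** The coordinates of x on the integral basis reduce to 0, hence are multiples of p: p is a
    uniformizer of the extension. *)
Lemma ext_vgt0_vge1 x : KK x -> (0 < ord x)%E -> vge 1 x.
Proof.
move=> xK x0; have [w [wO wfree _ [_ wspan _] wval]] := integral_basis.
have [c cQ xE] := wspan _ xK.
have c0 i : vge 0 (c i) by apply: (wval c) => //; rewrite -xE; exact: ltW.
have /boolp.choice[n nP] : forall i, exists n : nat, vge 1 (c i - n%:R).
  by move=> i; exact: (Qp_integral_nat pr_p hC (cQ i) (c0 i)).
have nw i : OK ((n i)%:R * w 0 i) by apply: intM => //; exact: int_nat.
have nsum : (0 < ord (\sum_i (n i)%:R * w 0 i))%E.
  have -> : \sum_i (n i)%:R * w 0 i = x - \sum_i w 0 i * (c i - (n i)%:R).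
    by rewrite xE -sumrB; apply: eq_bigr => i _; ring.
  rewrite (vgt0D hC) ?(vgt0N hC) //; apply: (vgt0_sum hC) => i _.
  apply: (vgt0Ml hC); first by have [] := wO i.
  exact: (vge1_vgt0 hC (nP i)).
have /wfree pn : \sum_i (n i)%:R * red (w 0 i) = 0.
  transitivity (red (\sum_i (n i)%:R * w 0 i)).
    rewrite red_sum //; apply: eq_bigr => i _.
    by rewrite (redM hred) ?red_nat //; exact: int_nat.
  by apply/(red_eq0 hred) => //; exact: int_sum.
rewrite xE; apply: (vge_sum hC) => i _; apply: (vgeMr hC); last by have [] := wO i.
have -> : c i = (c i - (n i)%:R) + (n i)%:R by ring.
by apply: (vgeD hC) => //; exact/(vge1_natP pr_p hC).
Qed.

Lemma ext_closed (u : nat -> C) l : (forall n, KK (u n)) -> ord_cvg ord u l -> KK l.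
Proof.
move=> uK ul; have [w [wO _ _ [_ wspan _] wval]] := integral_basis.
have /boolp.choice[c cP] : forall n, exists c : 'I_m -> C,
    (forall i, Qp (c i)) /\ u n = \sum_i c i * w 0 i.
  by move=> n; have [c c1 c2] := wspan _ (uK n); exists c.
have /boolp.choice[L LP] : forall i, exists L, ord_cvg ord (fun n => c n i) L.
  move=> i; apply: (Cp_complete hC) => A; have [N hN] := ul A; exists N => a b Na Nb.
  have cQ j : Qp (c a j - c b j) by apply: (QpB pr_p hC); have [] := cP a; have [] := cP b.
  apply: (wval (fun j => c a j - c b j) A cQ).
  have -> : \sum_j (c a j - c b j) * w 0 j = (u a - l) - (u b - l).
    have [_ ->] := cP a; have [_ ->] := cP b.
    have e (y z t : C) : y - t - (z - t) = y - z by ring.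
    by rewrite e -sumrB; apply: eq_bigr => j _; ring.
  exact: (vgeB hC (hN _ Na) (hN _ Nb)).
have -> : l = \sum_i L i * w 0 i.
  apply/eqP; rewrite -subr_eq0; apply/eqP/(vge_inf hC) => A.
  have [N hN] := ul A.
  have /boolp.choice[Ni hNi] : forall i, exists Ni, forall n, (Ni <= n)%N ->
      vge A (c n i - L i) by move=> i; have [Ni h] := LP i A; exists Ni.
  pose n := maxn N (\max_i Ni i).
  have -> : l - \sum_i L i * w 0 i =
      - (u n - l) + \sum_i w 0 i * (c n i - L i).
    have [_ ->] := cP n.
    have -> : \sum_i w 0 i * (c n i - L i) = \sum_i c n i * w 0 i - \sum_i L i * w 0 i.
      by rewrite -sumrB; apply: eq_bigr => i _; ring.
    by ring.
  apply: (vgeD hC); first by rewrite (vgeN hC); apply: hN; rewrite leq_maxl.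
  apply: (vge_sum hC) => i _; apply: (vgeMl hC); first by have [] := wO i.
  by apply: hNi; rewrite leq_max (leq_bigmax i) orbT.
apply: ext_sum => i; apply: extM; last by have [] := wO i.
apply: Qp_sub_ext; apply: (Qp_closed hC _ (LP i)) => n.
by have [] := cP n.
Qed.

(** The cofactor of a - b in a^p - b^p is congruent to p b^(p-1) modulo a - b, so its valuation is
    at least the smaller of 1 and E. *)
Lemma vge_expp (a b : C) (e E : R) : 0 <= e -> e <= 1 -> e <= E ->
  vge 0 a -> vge 0 b -> vge E (a - b) -> vge (E + e) (a ^+ p - b ^+ p).
Proof.
move=> e0 e1 eE a0 b0 ab; rewrite subrXX; apply: (vgeM hC) => //.
have -> : \sum_(i < p) a ^+ (p.-1 - i) * b ^+ i =
    \sum_(i < p) ((a ^+ (p.-1 - i) - b ^+ (p.-1 - i)) * b ^+ i) + p%:R * b ^+ p.-1.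
  have -> : p%:R * b ^+ p.-1 = \sum_(i < p) b ^+ p.-1.
    by rewrite sumr_const card_ord mulr_natl.
  rewrite -big_split; apply: eq_bigr => i _ /=.
  rewrite mulrBl -exprD subnK ?subrK // -ltnS prednK ?prime_gt0 //.
apply: (vgeD hC); last first.
  by apply: (vgeMr hC); [exact: vge_le e1 (vge_p hC)|exact: (vge0X hC)].
apply: (vge_sum hC) => i _; apply: (vgeMr hC); last exact: (vge0X hC).
rewrite subrXX; apply: (vgeMr hC); first exact: vge_le ab.
by apply: (vge_sum hC) => j _; apply: (vge0M hC); apply: (vge0X hC).
Qed.

Lemma vge_expq (a b : C) (e E : R) : 0 <= e -> e <= 1 -> e <= E ->
  vge 0 a -> vge 0 b -> vge E (a - b) -> vge (E + e) (a ^+ q - b ^+ q).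
Proof.
move=> e0 e1 eE a0 b0 ab; rewrite card_F.
suff h j : vge (E + e *+ j) (a ^+ (p ^ j) - b ^+ (p ^ j)).
  apply: vge_le (h m); rewrite -(prednK m_gt0) mulrS.
  have : 0 <= e *+ m.-1 by rewrite mulrn_wge0. lra.
elim: j => [|j IH]; first by rewrite mulr0n addr0 !expr1.
rewrite expnSr !exprM mulrSr addrA; apply: vge_expp => //; try exact: (vge0X hC).
have : 0 <= e *+ j by rewrite mulrn_wge0. lra.
Qed.

(** Raising to the power q fixes x and y, yet improves the bound on x - y by e each time. *)
Lemma teichmuller_unique x y : vge 0 x -> vge 0 y -> x ^+ q = x -> y ^+ q = y ->
  (0 < ord (x - y))%E -> x = y.
Proof.
move=> x0 y0 xq yq /(vgt0P hC)[e' e'0 h'].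
pose e := Num.min e' 1.
have e0 : 0 < e by rewrite lt_min e'0 ltr01.
have e1 : e <= 1 by rewrite ge_min lexx orbT.
have h : vge e (x - y) by apply: vge_le h'; rewrite ge_min lexx.
have hn n : vge (e + e *+ n) (x - y).
  elim: n => [|n IH]; first by rewrite mulr0n addr0.
  rewrite -xq -yq mulrSr addrA; apply: vge_expq => //; first exact: ltW.
  have : 0 <= e *+ n by rewrite mulrn_wge0 // ltW. lra.
apply/eqP; rewrite -subr_eq0; apply/eqP/(vge_inf hC) => A.
pose n := Num.bound `|A / e|.
have hb : A / e <= n%:R.
  exact: le_trans (ler_norm _) (ltW (archi_boundP (normr_ge0 (A / e)))).
apply: vge_le (hn n); rewrite ler_pdivrMr // mulr_natl in hb.
by apply: (le_trans hb); rewrite lerDr ltW.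
Qed.

Lemma teichmuller_exists u : exists x, [/\ OK x, x ^+ q = x & red x = u].
Proof.
have [x0 x0O x0u] := red_surj hred u; have [_ x00] := x0O.
pose y n := x0 ^+ (q ^ n).
have yO n : OK (y n) by exact: intX.
have y0 n : vge 0 (y n) by have [] := yO n.
have ured v n : v ^+ (q ^ n) = v :> F.
  by elim: n => [|n IH]; rewrite ?expr1 // expnS exprM expf_card.
have yS n : y n.+1 = y n ^+ q by rewrite /y expnSr exprM.
have step n : vge (n.+1)%:R (y n.+1 - y n).
  elim: n => [|n IH].
    (* The first two terms have the same residue; their difference lies in the extension, so its
       valuation is at least 1. *)
    apply: ext_vgt0_vge1; first by apply: extB; [have [] := yO 1%N|have [] := yO 0%N].
    by apply: red_eq_vgt0 => //; rewrite !redX // !ured.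
  rewrite -natr1 (yS n.+1) [X in _ - X]yS; apply: vge_expq => //.
  by rewrite ler1n.
have diff n k : vge (n.+1)%:R (y (n + k)%N - y n).
  elim: k => [|k IH]; first by rewrite addn0 subrr (vge0 hC).
  have -> : y (n + k.+1)%N - y n = (y (n + k).+1 - y (n + k)%N) + (y (n + k)%N - y n).
    by rewrite addnS; ring.
  by apply: (vgeD hC) => //; apply: vge_le (step _); rewrite ler_nat ltnS leq_addr.
have cau : ord_cauchy ord y.
  move=> A; pose N := Num.bound `|A|; exists N => a b Na Nb.
  have hN : A <= N.+1%:R.
    apply: le_trans (ler_norm _) (ltW (lt_trans (archi_boundP (normr_ge0 A)) _)).
    by rewrite ltr_nat.
  have dA c : (N <= c)%N -> vge A (y c - y N).
    by move=> h; rewrite -(subnKC h); exact: vge_le hN (diff _ _).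
  have -> : y a - y b = (y a - y N) - (y b - y N) by ring.
  exact: (vgeB hC (dA _ Na) (dA _ Nb)).
have [l yl] := Cp_complete hC cau.
have lK : KK l by apply: (ext_closed (u := y)) => // n; have [] := yO n.
have l0 : vge 0 l.
  have [N /(_ _ (leqnn N)) hN] := yl 0.
  have -> : l = y N - (y N - l) by ring.
  exact: (vgeB hC).
have lO : OK l by [].
exists l; split=> //; last first.
  have [N /(_ _ (leqnn N)) hN] := yl 1.
  rewrite -x0u -(_ : red (y N) = red x0); last by rewrite redX // ured.
  apply: red_eq => //; rewrite -opprB (vgt0N hC); exact: (vge1_vgt0 hC hN).
apply/eqP; rewrite -subr_eq0; apply/eqP/(vge_inf hC) => A.
pose B := Num.max A 1.
have AB : A <= B by rewrite le_max lexx.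
have B1 : 1 <= B by rewrite le_max lexx orbT.
have [N hN] := yl B; apply: (vge_le AB).
have -> : l ^+ q - l = (y N.+1 - l) - (y N ^+ q - l ^+ q).
  by rewrite yS; ring.
apply: (vgeB hC); first exact: hN.
have := @vge_expq (y N) l 1 B ler01 (lexx _) B1 (y0 _) l0 (hN _ (leqnn N)).
by apply: vge_le; lra.
Qed.

Local Notation tau := (@teichmuller R C ord K).

Lemma teichmullerP u : [/\ OK (tau u), tau u ^+ q = tau u & red (tau u) = u].
Proof. exact: (xgetPex 0 (teichmuller_exists u)). Qed.

Lemma teichmuller_eq x u : OK x -> x ^+ q = x -> red x = u -> tau u = x.
Proof.
move=> xO xq xu; have [tO tq tu] := teichmullerP u.
apply: teichmuller_unique => //; [by have [] := tO|by have [] := xO|].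
by apply: red_eq_vgt0 => //; rewrite tu.
Qed.

Lemma teichmuller0 : tau 0 = 0.
Proof.
apply: teichmuller_eq; [exact: (int_nat 0)| |exact: red0].
by rewrite expr0n gtn_eqF // ltnW // finNzRing_gt1.
Qed.

Lemma teichmuller1 : tau 1 = 1.
Proof.
by apply: teichmuller_eq; rewrite ?expr1n ?(red1 hred) //; exact: (int_nat 1).
Qed.

Lemma teichmullerM u v : tau (u * v) = tau u * tau v.
Proof.
have [uO uq ur] := teichmullerP u; have [vO vq vr] := teichmullerP v.
by apply: teichmuller_eq; [exact: intM|rewrite exprMn uq vq|rewrite (redM hred) ?ur ?vr].
Qed.

(** The q Teichmueller representatives exhaust the roots of X^q - X in [C]. This is how the
    representatives of a smaller field are found in a larger one. *)
Lemma root_of_unity_int x : x ^+ q = x -> OK x.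
Proof.
move=> xq; case: (pickP (fun u => tau u == x)) => [u /eqP <-|no].
  by have [] := teichmullerP u.
pose rs := x :: [seq tau u | u <- enum F].
have urs : uniq rs.
  rewrite /= map_inj_uniq ?enum_uniq ?andbT; last first.
    by move=> u v /(congr1 red); have [_ _ ->] := teichmullerP u; have [_ _ ->] := teichmullerP v.
  by apply/mapP => -[u _ xu]; have := no u; rewrite xu eqxx.
have sz : size ('X^q - 'X : {poly C}) = q.+1.
  by rewrite size_polyDl size_polyXn // size_polyN size_polyX ltnS finNzRing_gt1.
have := @max_poly_roots _ ('X^q - 'X) rs; rewrite -size_poly_eq0 sz.
move=> /(_ isT); rewrite /= size_map -cardE ltnn => /(_ _ urs) H.
suff: false by []; apply: H; rewrite rootE !hornerE xq subrr eqxx /=.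
apply/allP => _ /mapP[u _ ->].
by have [_ uq _] := teichmullerP u; rewrite rootE !hornerE uq subrr.
Qed.

(** On the integral basis, multiplication by x has an integral matrix; natural numbers congruent to
    its entries modulo p give both n and the matrix of multiplication by [red x]. *)
Lemma trace_mod_p x : OK x -> exists2 n,
  vge 1 (trace Qp KK x - n%:R) & n%:R = \sum_(i < m) red x ^+ (p ^ i).
Proof.
move=> xO; have [w [wO wfree rspan wB wval]] := integral_basis.
have [wK wspan _] := wB; have hQ := Qp_subfield pr_p hC.
have /boolp.choice[c cP] : forall j, exists c : 'I_m -> C,
    (forall i, Qp (c i)) /\ x * w 0 j = \sum_i c i * w 0 i.
  move=> j; have [|c c1 c2] := wspan (x * w 0 j); last by exists c.
  by apply: extM => //; have [] := xO.
pose M : 'M[C]_m := \matrix_(i, j) c j i.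
have MQ i j : Qp (M i j) by rewrite mxE; have [] := cP j.
have xw : x *: w = w *m M.
  apply/rowP => j; rewrite !mxE; have [_ ->] := cP j.
  by apply: eq_bigr => i _; rewrite mxE mulrC.
have tr_ex : is_trace Qp KK x (\tr M) by exists m, w, M.
have -> : trace Qp KK x = \tr M.
  have [n' [b [N [bB NQ xb trE]]]] : is_trace Qp KK x (trace Qp KK x).
    exact: (xgetPex 0 (ex_intro _ (\tr M) tr_ex)).
  rewrite trE.
  exact: trace_basis_indep hQ bB wB NQ MQ xb xw.
have M0 i j : vge 0 (M i j).
  rewrite mxE; have [cQ cE] := cP j; apply: (wval (c j)) => //; rewrite -cE.
  by have [] := intM xO (wO j).
have /boolp.choice[N NP] : forall ij : 'I_m * 'I_m, exists n : nat, vge 1 (M ij.1 ij.2 - n%:R).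
  by move=> ij; exact: (Qp_integral_nat pr_p hC (MQ _ _) (M0 _ _)).
exists (\sum_i N (i, i))%N.
  by rewrite natr_sum -sumrB; apply: (vge_sum hC) => i _; exact: (NP (i, i)).
rewrite natr_sum.
apply: (@residue_trace _ _ _ pr_p card_F (\row_i red (w 0 i)) _ (fun i j => N (i, j)) m_gt0).
  move=> y; have [d ->] := rspan y; exists d; apply: eq_bigr => i _; by rewrite mxE.
move=> j; rewrite mxE -(redM hred) //.
have nw i : OK (w 0 i * (N (i, j))%:R) by apply: intM => //; exact: int_nat.
transitivity (red (\sum_i w 0 i * (N (i, j))%:R)); last first.
  rewrite red_sum //; apply: eq_bigr => i _.
  by rewrite mxE (redM hred) ?red_nat //; exact: int_nat.
apply: red_eq; [exact: intM|exact: int_sum|].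
have -> : x * w 0 j - \sum_i w 0 i * (N (i, j))%:R = \sum_i w 0 i * (M i j - (N (i, j))%:R).
  have := congr1 (fun z : 'rV[C]_m => z 0 j) xw; rewrite !mxE => ->.
  by rewrite -sumrB; apply: eq_bigr => i _; ring.
apply: (vgt0_sum hC) => i _; apply: (vgt0Ml hC); first by have [] := wO i.
exact: (vge1_vgt0 hC (NP (i, j))).
Qed.

End Unramified.

Lemma expZpE (R : realType) (C : closedFieldType) (p : nat) (ord : C -> \bar R)
    (pr_p : prime p) (hC : is_Cp p ord) (zeta t : C) n :
  zeta ^+ p = 1 -> ord_ge ord 1 (t - n%:R) -> expZp ord zeta t = zeta ^+ n.
Proof.
move=> zp tn; rewrite /expZp; set k := xget _ _.
have tk : [set i : nat | (1%:E <= ord (t - i%:R)%R)%E]%classic k.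
  by apply: xgetPex; exists n.
rewrite -(expr_mod k zp) -(expr_mod n zp); congr (_ ^+ _).
apply: (vge0_nat_diff pr_p hC).
have -> : k%:R - n%:R = (t - n%:R) - (t - k%:R) :> C by ring.
exact: (vgeB hC).
Qed.

(** * Characters of the residue fields *)

Section PrimeFieldCharacter.
Local Open Scope classical_set_scope.
Variables (C : fieldType) (zeta : C) (p : nat).
Hypothesis (zeta_p : zeta ^+ p = 1).

(* Only meaningful on the prime field of F. *)
Definition prime_char (F : finFieldType) (y : F) : C :=
  zeta ^+ (if [pick n : 'I_p | (n : nat)%:R == y] is Some n then n else 0%N).

Lemma prime_char_nat (F : finFieldType) n : p \in [pchar F] ->
  prime_char (n%:R : F) = zeta ^+ n.
Proof.
move=> chp; have p0 : (0 < p)%N by rewrite prime_gt0 // (pcharf_prime chp).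
have nE : ((n %% p)%:R : F) = n%:R.
  by rewrite [in RHS](divn_eq n p) natrD natrM (pcharf0 chp) mulr0 add0r.
rewrite /prime_char; case: pickP => [i /eqP iE|/(_ (Ordinal (ltn_pmod n p0)))]; last first.
  by rewrite /= nE eqxx.
rewrite -(expr_mod i zeta_p) -(expr_mod n zeta_p); congr (_ ^+ _).
move: (i : nat) iE => {i nE} i.
wlog le_in : n i / (n <= i)%N => [th iE|iE].
  by have [/th|/ltnW/th h] := leqP n i; [apply|apply/esym/h].
by apply/eqP; rewrite eqn_mod_dvd // (dvdn_pcharf chp) natrB // iE subrr.
Qed.

End PrimeFieldCharacter.

(** * Embeddings of residue fields and reduction of the exponential sums *)

Section ResidueEmbedding.
Local Open Scope classical_set_scope.
Variables (R : realType) (C : closedFieldType) (p : nat) (ord : C -> \bar R).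
Hypotheses (pr_p : prime p) (hC : is_Cp p ord).
Variables (K K' : local_ext C) (m k : nat).
Hypotheses (m_gt0 : (0 < m)%N) (k_gt0 : (0 < k)%N).
Hypotheses (hK : is_unramified p ord m K) (hK' : is_unramified p ord (m * k) K').
Local Notation tau := (@teichmuller R C ord K).
Local Notation tau' := (@teichmuller R C ord K').

Let mk_gt0 : (0 < m * k)%N. Proof. by rewrite muln_gt0 m_gt0. Qed.

Lemma teichmuller_int u : integers ord K' (tau u).
Proof.
have [_ uq _] := teichmullerP pr_p hC m_gt0 hK u.
apply: (root_of_unity_int pr_p hC mk_gt0 hK').
rewrite (unram_resdegree hK') expnM -(unram_resdegree hK).
by elim: (k) => [|j IH]; rewrite ?expr1 // expnS exprM uq.
Qed.

(** Additivity: tau(u - v) and tau(u) - tau(v) differ by an element of positive valuation, a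
    condition inside [C] that is the same for [K] and for [K']. *)
Lemma residue_embedding : exists iota : {rmorphism resfield K -> resfield K'},
  forall u, iota u = red K' (tau u).
Proof.
have hr := unram_reduction hK; have hr' := unram_reduction hK'.
pose f u := red K' (tau u).
have fM : {morph f : u v / u * v}.
  move=> u v; rewrite /f (teichmullerM pr_p hC m_gt0 hK) (redM hr') //; exact: teichmuller_int.
have f1 : f 1 = 1 by rewrite /f (teichmuller1 pr_p hC m_gt0 hK) (red1 hr').
have fB : zmod_morphism f.
  move=> u v; rewrite /f -(redB hr'); [|exact: teichmuller_int..].
  apply: (red_eq hC hK'); [exact: teichmuller_int| |].
    by apply: (intB hC hK'); exact: teichmuller_int.
  have [uO _ ur] := teichmullerP pr_p hC m_gt0 hK u.
  have [vO _ vr] := teichmullerP pr_p hC m_gt0 hK v.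
  have [wO _ wr] := teichmullerP pr_p hC m_gt0 hK (u - v).
  apply: (red_eq_vgt0 hC hK) => //; first exact: (intB hC hK).
  by rewrite wr (redB hr) // ur vr.
pose f_add := GRing.isZmodMorphism.Build _ _ f fB.
pose f_mul := GRing.isMonoidMorphism.Build _ _ f (f1, fM).
pose F : {rmorphism resfield K -> resfield K'} := HB.pack f f_add f_mul.
by exists F.
Qed.

Lemma expZp_trace_residue (zeta : C) (g : {poly resfield K})
    (iota : {rmorphism resfield K -> resfield K'}) u :
  zeta ^+ p = 1 -> (forall v, iota v = red K' (tau v)) ->
  expZp ord zeta (trace (Qp ord) (ext_carrier K') (map_poly tau g).[tau' u]) =
  prime_char zeta p (\sum_(i < m * k) (map_poly iota g).[u] ^+ (p ^ i)).
Proof.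
move=> zp iE; have hr' := unram_reduction hK'.
have [uO _ ur] := teichmullerP pr_p hC mk_gt0 hK' u.
pose x := (map_poly tau g).[tau' u].
have xE : x = \sum_(i < size g) tau g`_i * tau' u ^+ i.
  rewrite /x (horner_coef_wide _ (size_poly _ _)).
  by apply: eq_bigr => i _; rewrite coef_map_id0 // (teichmuller0 pr_p hC m_gt0 hK).
have tO i : integers ord K' (tau g`_i * tau' u ^+ i).
  by apply: (intM hC hK'); [exact: teichmuller_int|exact: (intX hC hK')].
have xO : integers ord K' x by rewrite xE; apply: (int_sum hC hK') => i.
have rx : red K' x = (map_poly iota g).[u].
  rewrite xE (red_sum hC hK'); last by move=> i.
  rewrite (horner_coef_wide _ (size_poly _ _)); apply: eq_bigr => i _.
  rewrite coef_map /= iE (redM hr') ?(redX hC hK') ?ur //; first exact: teichmuller_int.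
  exact: (intX hC hK').
have [n tn nE] := trace_mod_p pr_p hC mk_gt0 hK' xO.
rewrite -/x (expZpE pr_p hC zp tn) -rx -nE prime_char_nat //.
exact: (finField_pchar pr_p (unram_resdegree hK')).
Qed.

End ResidueEmbedding.

(** * Power sums of the roots *)

Section Reversal.
Variable F : comNzRingType.
Implicit Types u v : {poly F}.

(** The reciprocal polynomial X^d u(1/X), for u of degree at most d. *)
Definition rev_poly d u : {poly F} := \poly_(i < d.+1) u`_(d - i).

Lemma rev_polyE d u : rev_poly d u = \sum_(c < d.+1) u`_c *: 'X^(d - c).
Proof.
apply/polyP => i; rewrite coef_poly coef_sum; case: ltnP => id.
  have di : (d - i < d.+1)%N by rewrite ltnS leq_subr.
  rewrite (bigD1 (Ordinal di)) //= coefZ coefXn subKn // eqxx mulr1 big1 ?addr0 //.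
  move=> c ci; rewrite coefZ coefXn; case: eqP => [iE|_]; last by rewrite mulr0.
  by case/eqP: ci; apply: val_inj; rewrite /= iE subKn // -ltnS.
by rewrite big1 // => c _; rewrite coefZ coefXn gtn_eqF ?mulr0 // (leq_ltn_trans (leq_subr _ _)).
Qed.

Lemma rev_polyM m n u v : (size u <= m.+1)%N -> (size v <= n.+1)%N ->
  rev_poly (m + n) (u * v) = rev_poly m u * rev_poly n v.
Proof.
move=> su sv.
have lin d (I : Type) (r : seq I) (f : I -> {poly F}) :
    rev_poly d (\sum_(i <- r) f i) = \sum_(i <- r) rev_poly d (f i).
  apply: (big_morph (rev_poly d)) => [x y|].
    by rewrite !rev_polyE -big_split; apply: eq_bigr => i _; rewrite coefD scalerDl.
  by rewrite rev_polyE big1 // => i _; rewrite coef0 scale0r.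
have revX d a c : (c <= d)%N -> rev_poly d (a *: 'X^c) = a *: 'X^(d - c).
  move=> cd; have cd' : (c < d.+1)%N by [].
  rewrite rev_polyE (bigD1 (Ordinal cd')) //= coefZ coefXn eqxx mulr1 big1 ?addr0 //.
  by move=> i ic; rewrite coefZ coefXn (_ : (_ == c) = false) ?mulr0 ?scale0r //; apply: negbTE.
have polyE (w : {poly F}) d : (size w <= d.+1)%N -> w = \sum_(i < d.+1) w`_i *: 'X^i.
  move=> sw; rewrite -[LHS]coefK poly_def (big_ord_widen _ (fun i => w`_i *: 'X^i) sw).
  rewrite big_mkcond; apply: eq_bigr => i _; case: ltnP => // h.
  by rewrite nth_default // scale0r.
rewrite [in LHS](polyE u m su) mulr_suml lin rev_polyE mulr_suml.
apply: eq_bigr => i _; rewrite [in LHS](polyE v n sv) mulr_sumr lin rev_polyE mulr_sumr.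
apply: eq_bigr => j _; have im := ltn_ord i; have jn := ltn_ord j.
rewrite -!scalerAl -!scalerAr !scalerA -!exprD revX; last by rewrite leq_add.
by rewrite subnDA -addnBAC // -addnBA // mulrC.
Qed.

End Reversal.

(** * Additivity of p_1 + p_3 + p_4 on products of monic polynomials *)

Section PowerSums.
Variable F : fieldType.
Implicit Types u v : {poly F}.

(** For monic u, this is (-1)^i e_i of the roots, and 0 beyond the degree. *)
Definition rcoef i u := (rev_poly (size u).-1 u)`_i.

Lemma rcoefM i u v : u \is monic -> v \is monic ->
  rcoef i (u * v) = \sum_(j < i.+1) rcoef j u * rcoef (i - j) v.
Proof.
move=> mu mv; rewrite /rcoef -coefM -rev_polyM; last 2 first.
- by rewrite prednK // size_poly_gt0 monic_neq0.
- by rewrite prednK // size_poly_gt0 monic_neq0.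
have : (0 < size u)%N by rewrite size_poly_gt0 monic_neq0.
have : (0 < size v)%N by rewrite size_poly_gt0 monic_neq0.
rewrite size_mul ?monic_neq0 //; case: (size u) => // a; case: (size v) => // b _ _.
by rewrite addSn addnS.
Qed.

Lemma rcoef0 u : u \is monic -> rcoef 0 u = 1.
Proof. by rewrite /rcoef coef_poly subn0 monicE lead_coefE => /eqP. Qed.

(* Newton's identities for p_1 + p_3 + p_4 in terms of the signed elementary
   symmetric functions r_i = (-1)^i e_i. *)
Definition newton134 (r1 r2 r3 r4 : F) : F :=
  - r1 + (- r1 ^+ 3 + 3%:R * r1 * r2 - 3%:R * r3) +
  (r1 ^+ 4 - 4%:R * r1 ^+ 2 * r2 + 2%:R * r2 ^+ 2 + 4%:R * r1 * r3 - 4%:R * r4).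

Definition hsum u := newton134 (rcoef 1 u) (rcoef 2 u) (rcoef 3 u) (rcoef 4 u).

(** Power sums are additive over the union of the roots; here this is a polynomial identity in the
    [rcoef], whose convolution rule comes from the reciprocal polynomials. *)
Lemma hsumM u v : u \is monic -> v \is monic -> hsum (u * v) = hsum u + hsum v.
Proof.
move=> mu mv; rewrite /hsum /newton134 !rcoefM // !big_ord_recl !big_ord0 /= /bump /=.
by rewrite !subn0 ?subSS !subn0 !rcoef0 //; ring.
Qed.

Lemma hsum_XsubC (a : F) : hsum ('X - a%:P) = a ^+ 4 + a ^+ 3 + a.
Proof.
rewrite /hsum /newton134 /rcoef size_XsubC /= !coef_poly /= subnn.
by rewrite coefB coefX coefC /= sub0r; ring.
Qed.

Lemma hsum1 : hsum 1 = 0.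
Proof. by rewrite /hsum /newton134 /rcoef size_poly1 !coef_poly /=; ring. Qed.

Lemma hsum_prod (I : Type) (r : seq I) (a : I -> F) :
  hsum (\prod_(i <- r) ('X - (a i)%:P)) = \sum_(i <- r) (a i ^+ 4 + a i ^+ 3 + a i).
Proof.
elim: r => [|i r IH]; first by rewrite !big_nil hsum1.
by rewrite !big_cons hsumM ?monicXsubC ?monic_prod_XsubC // hsum_XsubC IH.
Qed.

End PowerSums.

Lemma hsum_map (F E : fieldType) (iota : {rmorphism F -> E}) u :
  hsum (map_poly iota u) = iota (hsum u).
Proof.
have rc i : rcoef i (map_poly iota u) = iota (rcoef i u).
  rewrite /rcoef size_map_poly [LHS]coef_poly [in RHS]coef_poly.
  case: ltnP => _; last by rewrite rmorph0.
  by rewrite coef_map.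
by rewrite /hsum /newton134 !rc; ring.
Qed.

(** * Splitting the exponential sum over squares *)

Section SquareFibres.
Variables (E : finFieldType) (N : nat).
Hypothesis card_E : #|E| = (2 * N).+1.

Let expN2 (y : E) : y != 0 -> y ^+ (2 * N) = 1.
Proof.
by move=> y0; apply: (mulfI y0); rewrite -exprS -card_E expf_card mulr1.
Qed.

Let two_neq0 : (2%:R : E) != 0.
Proof.
apply/eqP => h; have ch2 : 2%N \in [pchar E] by rewrite inE /= h eqxx.
have := card_pprimeChar ch2; rewrite -[#|_|]/#|E| card_E.
have : (0 < N)%N by have := finNzRing_gt1 E; rewrite card_E; case: (N).
case: (logn 2 _) => [|n]; first by move=> h1 /eqP; rewrite eqSS muln_eq0 /= gtn_eqF.
by move=> _ /(congr1 odd); rewrite expnS /= !oddM.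
Qed.

Let card_fibre_sq (y : E) : y != 0 -> #|[set z : E | z ^+ 2 == y ^+ 2]| = 2.
Proof.
move=> y0; have -> : [set z : E | z ^+ 2 == y ^+ 2] = [set y; - y].
  by apply/finset.setP => z; rewrite !inE eqf_sqr.
rewrite cards2; case: eqVneq => // e.
have /eqP : 2%:R * y = 0 by rewrite mulr_natl mulr2n {1}e addNr.
by rewrite mulf_eq0 (negbTE two_neq0) (negbTE y0).
Qed.

Let squares := [set x : E | [exists y, (y != 0) && (y ^+ 2 == x)]].

Let card_squares : #|squares| = N.
Proof.
have : \sum_(y : E | y != 0) 1%N = (2 * N)%N.
  rewrite sum1_card; apply/eqP; rewrite -eqSS -card_E -cardsT (cardsD1 0) inE add1n eqSS.
  by apply/eqP; rewrite -cardsE; congr #|pred_of_set _|; apply/finset.setP => y; rewrite !inE andbT.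
rewrite (partition_big (fun y : E => y ^+ 2) (fun x => x \in squares)) /=; last first.
  by move=> y y0; rewrite inE; apply/existsP; exists y; rewrite y0 eqxx.
rewrite (eq_bigr (fun _ => 2%N)) => [|x].
  by rewrite sum_nat_const mulnC => /eqP; rewrite eqn_pmul2l // => /eqP.
rewrite inE => /existsP[y /andP[y0 /eqP <-]].
apply: etrans (card_fibre_sq y0); rewrite -sum1_card; apply: eq_bigl => z; rewrite inE.
case: (z ^+ 2 =P y ^+ 2) => [zy|_]; last by rewrite andbF.
by rewrite andbT; apply: contra y0 => /eqP z0; rewrite -sqrf_eq0 -zy z0 expr0n.
Qed.

(** Euler's criterion: squaring is two to one on nonzero elements, so there are N nonzero squares,
    and they exhaust the roots of X^N - 1. *)
Lemma card_square_fibre (x : E) : x != 0 ->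
  #|[set y : E | y ^+ 2 == x]| = if x ^+ N == 1 then 2%N else 0%N.
Proof.
move=> x0; case: (boolP (x \in squares)) => [|xs].
  rewrite inE => /existsP[y /andP[y0 /eqP <-]].
  by rewrite card_fibre_sq // -exprM expN2 // eqxx.
have -> : [set y : E | y ^+ 2 == x] = finset.set0.
  apply/finset.setP => y; rewrite !inE; apply/negP => yx; case/negP: xs.
  rewrite inE; apply/existsP; exists y; rewrite yx andbT.
  by apply: contra x0 => /eqP y0; rewrite -(eqP yx) y0 expr0n.
rewrite cards0; case: eqP => // xN.
have N0 : (0 < N)%N by have := finNzRing_gt1 E; rewrite card_E; case: (N).
have sz : size ('X^N - 1 : {poly E}) = N.+1 by rewrite size_XnsubC.
have := @max_poly_roots _ ('X^N - 1) (x :: enum squares); rewrite -size_poly_eq0 sz.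
move=> /(_ isT); rewrite /= -cardE card_squares ltnn enum_uniq mem_enum xs => H.
suff : false by []; apply: H => //; rewrite rootE !hornerE xN subrr eqxx /=.
apply/allP => z; rewrite mem_enum inE => /existsP[y /andP[y0 /eqP <-]].
by rewrite rootE !hornerE -exprM expN2 // subrr.
Qed.

Lemma sum_over_squares (R : pzRingType) (G : E -> R) :
  \sum_(y : E | y != 0) G (y ^+ 2) =
  \sum_(x : E | x != 0) (if x ^+ N == 1 then 2%:R else 0) * G x.
Proof.
rewrite (partition_big (fun y : E => y ^+ 2) (fun x => x != 0)) /=; last first.
  by move=> y y0; rewrite expf_neq0.
apply: eq_bigr => x x0.
transitivity (\sum_(y in [set y : E | y ^+ 2 == x]) G x).
  apply: eq_big => [y|y /andP[_ /eqP -> //]]; rewrite !inE.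
  case: (y ^+ 2 =P x) => [yx|_]; last by rewrite andbF.
  by rewrite andbT; apply: contra x0 => /eqP y0; rewrite -yx y0 expr0n.
by rewrite sumr_const card_square_fibre //; case: ifP => _; rewrite ?mulr_natl ?mul0r.
Qed.

End SquareFibres.

(** * Characters of F_25 and their composition with trace and norm *)

Section Characters.
Variables (C : fieldType) (zeta : C).
Hypothesis zeta5 : zeta ^+ 5 = 1.
Local Notation psi := (prime_char zeta 5).

Lemma prime_field_fixed (E : finFieldType) (y : E) : 5%N \in [pchar E] ->
  y ^+ 5 = y -> exists n : nat, y = n%:R.
Proof.
move=> ch5 y5; pose V := pPrimeCharType ch5.
have [|a aE] := @fixed_in_image 'F_5 V (in_alg V) (y : V).
  by rewrite card_Fp.
exists (a : nat); rewrite -[LHS]aE /=.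
by change ((a : nat)%:R * (1 : E) = (a : nat)%:R); rewrite mulr1.
Qed.

Lemma prime_charD (E : finFieldType) (y z : E) : 5%N \in [pchar E] ->
  y ^+ 5 = y -> z ^+ 5 = z -> psi (y + z) = psi y * psi z.
Proof.
move=> ch5 /(prime_field_fixed ch5)[m ->] /(prime_field_fixed ch5)[n ->].
by rewrite -natrD !prime_char_nat // exprD.
Qed.

Lemma prime_char_map (E E' : finFieldType) (f : {rmorphism E -> E'}) (y : E) :
  5%N \in [pchar E] -> y ^+ 5 = y -> psi (f y) = psi y.
Proof.
move=> ch5 /(prime_field_fixed ch5)[n ->]; rewrite rmorph_nat !prime_char_nat //.
by rewrite (rmorph_pchar f).
Qed.

Variable F : finFieldType.
Hypothesis card_F : #|F| = 25%N.

Lemma F25_char5 : 5%N \in [pchar F]. Proof. exact: (@card_finPcharP F 5 2 card_F). Qed.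

Lemma five_F25 : 5%:R = 0 :> F. Proof. exact: (pcharf0 F25_char5). Qed.

Definition tr25 (y : F) := y + y ^+ 5.

Lemma exp5D (x y : F) : (x + y) ^+ 5 = x ^+ 5 + y ^+ 5.
Proof. by rewrite exprDn_pchar // pnatE // F25_char5. Qed.

Lemma exp25 (x : F) : x ^+ 25 = x. Proof. by rewrite -card_F expf_card. Qed.

Lemma tr25D x y : tr25 (x + y) = tr25 x + tr25 y.
Proof. by rewrite /tr25 exp5D; ring. Qed.

Lemma tr25_fixed y : tr25 y ^+ 5 = tr25 y.
Proof. by rewrite /tr25 exp5D -exprM exp25 addrC. Qed.

Definition psi25 (y : F) := psi (tr25 y).

Lemma psi25D x y : psi25 (x + y) = psi25 x * psi25 y.
Proof. by rewrite /psi25 tr25D prime_charD ?F25_char5 ?tr25_fixed. Qed.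

Lemma psi25_0 : psi25 0 = 1.
Proof.
rewrite /psi25 /tr25 expr0n addr0 -[0]/(0%:R).
by rewrite (prime_char_nat zeta5 0 F25_char5) expr0.
Qed.

Definition nonzero_char (c : F) : C := (c != 0)%:R.
(** The exponent is 12 = (25 - 1)/2. *)
Definition quad_char (c : F) : C := if c == 0 then 0 else if c ^+ 12 == 1 then 1 else -1.

Lemma nonzero_charM c d : nonzero_char (c * d) = nonzero_char c * nonzero_char d.
Proof. by rewrite /nonzero_char mulf_eq0 negb_or -natrM mulnb. Qed.

Lemma exp12_sign (c : F) : c != 0 -> (c ^+ 12 == 1) || (c ^+ 12 == -1).
Proof.
move=> c0; rewrite -sqrf_eq1 -exprM; apply/eqP/(mulfI c0).
by rewrite -exprS exp25 mulr1.
Qed.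

Lemma F25_neqN1 : (-1 == 1 :> F) = false.
Proof.
apply/negP => /eqP e; have : 2%:R == 0 :> F by rewrite -[2%N]/(1 + 1)%N natrD -{1}e addNr.
by rewrite -(dvdn_pcharf F25_char5).
Qed.

Lemma quad_charM c d : quad_char (c * d) = quad_char c * quad_char d.
Proof.
rewrite /quad_char mulf_eq0; case: eqVneq => [|c0]; first by rewrite mul0r.
case: eqVneq => [|d0] /=; first by rewrite mulr0.
rewrite exprMn; case/orP: (exp12_sign c0) => /eqP ->; case/orP: (exp12_sign d0) => /eqP ->;
by rewrite ?mul1r ?mulr1 ?mulrNN ?mulr1 ?eqxx ?F25_neqN1 ?eqxx ?mulr1 ?mul1r ?mulrNN ?mulr1.
Qed.

Definition Psi (w : F -> C) (mu : F) (u : {poly F}) : C := w u.[0] * psi25 (mu * hsum u).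

Lemma PsiM w mu : {morph w : c d / c * d} -> forall u v, u \is monic -> v \is monic ->
  Psi w mu (u * v) = Psi w mu u * Psi w mu v.
Proof.
by move=> wM u v mu' mv; rewrite /Psi hornerM wM hsumM // mulrDr psi25D mulrACA.
Qed.

Section Point.
Variables (E : finFieldType) (iota : {rmorphism F -> E}) (k : nat).
Hypotheses (k_gt0 : (0 < k)%N) (card_E : #|E| = (#|F| ^ k)%N).

(** This is (25^k - 1)/2, written so that x^N is visibly the 12th power of the norm of x, the
    product of the x^(25^i). *)
Let N := (\sum_(i < k) 12 * 25 ^ i)%N.

Lemma card_E_odd : #|E| = (2 * N).+1.
Proof.
rewrite card_E card_F /N; elim: (k) => [|j IH]; first by rewrite big_ord0.
by rewrite expnSr big_ord_recr /= mulnDr -addSn -IH; ring.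
Qed.

Lemma E_char5 : 5%N \in [pchar E]. Proof. exact: (rmorph_pchar iota F25_char5). Qed.

Definition psiE (y : E) := psi (\sum_(i < 2 * k) y ^+ (5 ^ i)).

(** Transitivity of the trace: the 2k conjugates of y over F_5 are grouped in pairs y^(25^i),
    (y^(25^i))^5. *)
Lemma psi25_charpoly mu x :
  psi25 (mu * hsum (frob_charpoly iota k x)) =
  psiE (iota mu * (x ^+ 4 + x ^+ 3 + x)).
Proof.
rewrite /psi25 -(prime_char_map iota F25_char5 (tr25_fixed _)) /tr25 rmorphD rmorphXn rmorphM.
rewrite -hsum_map frob_charpolyE // /conj_poly hsum_prod /psiE; congr (psi _).
pose y := iota mu * (x ^+ 4 + x ^+ 3 + x); rewrite -/y.
have pnat5 j : [pchar E].-nat (5 ^ j)%N by rewrite pnatX pnatE // E_char5.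
have hx i : iota mu * ((x ^+ (#|F| ^ i)) ^+ 4 + (x ^+ (#|F| ^ i)) ^+ 3 + x ^+ (#|F| ^ i)) =
    y ^+ (5 ^ (2 * i)).
  rewrite /y exprMn !exprDn_pchar // card_F expnM -!exprM ![(25 ^ i * _)%N]mulnC !exprM.
  congr (_ * _); rewrite -rmorphXn; congr (iota _).
  by elim: (i) => [|j IH]; rewrite ?expr1 // expnSr exprM -IH exp25.
have -> : \sum_(i < 2 * k) y ^+ (5 ^ i) =
    \sum_(i < k) (y ^+ (5 ^ (2 * i)) + (y ^+ (5 ^ (2 * i))) ^+ 5).
  elim: (k) => [|j IH]; first by rewrite !big_ord0.
  rewrite mulnS addnC addn2 2!big_ord_recr IH big_ord_recr /= -addrA.
  by rewrite expnSr exprM.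
rewrite mulr_sumr big_split /=; congr (_ + _); first by apply: eq_bigr => i _; rewrite hx.
rewrite (big_morph (fun z : E => z ^+ 5) (id1 := 0) (op1 := +%R)); last 2 first.
- by move=> a b; rewrite exprDn_pchar // (pnat5 1%N).
- by rewrite expr0n.
by apply: eq_bigr => i _; rewrite hx.
Qed.

Lemma charpoly_at0 x : iota (frob_charpoly iota k x).[0] = \prod_(i < k) (- x ^+ (25 ^ i)).
Proof.
rewrite -horner_map rmorph0 frob_charpolyE // /conj_poly horner_prod.
by apply: eq_bigr => i _; rewrite !hornerE card_F.
Qed.

Lemma charpoly_at0_eq0 x : ((frob_charpoly iota k x).[0] == 0) = (x == 0).
Proof.
rewrite -(fmorph_eq0 iota) charpoly_at0; apply/idP/eqP => [|->].
  move=> /prodf_eq0[i _]; rewrite oppr_eq0 expf_eq0 => /andP[_ /eqP //].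
apply/prodf_eq0; exists (Ordinal k_gt0) => //.
by rewrite oppr_eq0 expf_eq0 eqxx andbT expn_gt0.
Qed.

Lemma nonzero_char_charpoly x : nonzero_char (frob_charpoly iota k x).[0] = (x != 0)%:R.
Proof. by rewrite /nonzero_char charpoly_at0_eq0. Qed.

Lemma quad_char_charpoly x : x != 0 ->
  quad_char (frob_charpoly iota k x).[0] = if x ^+ N == 1 then 1 else -1.
Proof.
move=> x0; rewrite /quad_char charpoly_at0_eq0 (negbTE x0).
rewrite -(fmorph_eq1 iota) rmorphXn charpoly_at0 -prodrXl.
rewrite (eq_bigr (fun i : 'I_k => x ^+ (12 * 25 ^ i))); last first.
  (* The signs in the constant coefficient disappear because 12 is even. *)
  by move=> i _; rewrite exprNn -exprM mulnC -signr_odd /= mul1r.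
by rewrite -expr_sum.
Qed.

(* Each nonzero x is the square of 1 + chi(x) elements, chi the quadratic
   character of E, which is the quadratic character of F composed with the norm. *)
Lemma point_sum_split mu :
  \sum_(y : E | y != 0) psiE (iota mu * (y ^+ 8 + y ^+ 6 + y ^+ 2)) =
  \sum_(x : E) Psi nonzero_char mu (frob_charpoly iota k x) +
  \sum_(x : E) Psi quad_char mu (frob_charpoly iota k x).
Proof.
pose G x := psiE (iota mu * (x ^+ 4 + x ^+ 3 + x)).
transitivity (\sum_(y : E | y != 0) G (y ^+ 2)).
  by apply: eq_bigr => y _; rewrite /G -!exprM.
rewrite (sum_over_squares card_E_odd) -big_split [RHS](bigID (fun x => x != 0)) /=.
rewrite [X in _ + X]big1 ?addr0 => [|x]; last first.
  rewrite negbK => /eqP ->; rewrite /Psi /nonzero_char /quad_char charpoly_at0_eq0.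
  by rewrite eqxx !mul0r addr0.
apply: eq_bigr => x x0; rewrite /Psi psi25_charpoly -/(G x) -mulrDl.
rewrite nonzero_char_charpoly quad_char_charpoly // x0; congr (_ * _).
by case: ifP => _; rewrite ?subrr // -natrD.
Qed.

End Point.
End Characters.

(** * Character sums over monic polynomials *)

Section Model.
Local Open Scope nat_scope.

(* (a, b) stands for a + b lambda in F_25, where lambda ^ 2 = 2. *)
Definition p25 := (nat * nat)%type.

Definition els25 : seq p25 := [seq (a, b) | a <- iota 0 5, b <- iota 0 5].
Definition add25 (x y : p25) : p25 := ((x.1 + y.1) %% 5, (x.2 + y.2) %% 5).
Definition mul25 (x y : p25) : p25 :=
  ((x.1 * y.1 + 2 * (x.2 * y.2)) %% 5, (x.1 * y.2 + x.2 * y.1) %% 5).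
Definition scal25 c (x : p25) : p25 := ((c * x.1) %% 5, (c * x.2) %% 5).

(* The coefficients of newton134 reduced modulo 5. *)
Definition newton25 (r1 r2 r3 r4 : p25) : p25 :=
  let s := mul25 r1 r1 in
  add25 (scal25 4 r1) (add25 (mul25 r1 (add25 (add25 (scal25 4 s) (scal25 3 r2)) (scal25 4 r3)))
    (add25 (mul25 s (add25 s r2)) (add25 (scal25 2 (mul25 r2 r2)) (add25 (scal25 2 r3) r4)))).

(** The trace to F_5 of x or of lambda x: Tr(a + b lambda) = 2a and Tr(lambda (a + b lambda)) =
    4b. *)
Definition phase (twist : bool) (x : p25) : nat := if twist then 4 * x.2 else 2 * x.1.

End Model.

(** The norm of a + b lambda is a^2 - 2b^2 = a^2 + 3b^2 modulo 5, and its square is the 12th power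
    of a + b lambda. *)
Definition weight (quad : bool) (x : p25) : int :=
  if x == (0, 0)%N then 0 else
  if quad then (if ((x.1 ^ 2 + 3 * x.2 ^ 2) ^ 2 %% 5 == 1)%N then 1 else -1) else 1.

(** Coordinates on 1, zeta, ..., zeta^4. They are not unique; the cyclotomic relation is applied
    only after summation. *)
Definition vec := (int * int * int * int * int)%type.

Definition vadd (u v : vec) : vec :=
  let: (a0, a1, a2, a3, a4) := u in let: (b0, b1, b2, b3, b4) := v in
  (a0 + b0, a1 + b1, a2 + b2, a3 + b3, a4 + b4).

Definition vmono (j : nat) (s : int) : vec :=
  match (j %% 5)%N with
  | 0 => (s, 0, 0, 0, 0) | 1 => (0, s, 0, 0, 0) | 2 => (0, 0, s, 0, 0)
  | 3 => (0, 0, 0, s, 0) | _ => (0, 0, 0, 0, s) end.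

Definition vsum (f : p25 -> vec) : vec :=
  foldr (fun x acc => vadd (f x) acc) (0, 0, 0, 0, 0) els25.

(** In these counts [a] runs over the constant coefficient, which carries the weight and is the last
    r_i that can be nonzero. *)
Definition count1 t q := vsum (fun a =>
  vmono (phase t (newton25 a (0, 0) (0, 0) (0, 0))%N) (weight q a)).
Definition count2 t q := vsum (fun a => vsum (fun b =>
  vmono (phase t (newton25 b a (0, 0) (0, 0))%N) (weight q a))).
Definition count3 t q := vsum (fun a => vsum (fun b => vsum (fun c =>
  vmono (phase t (newton25 c b a (0, 0))%N) (weight q a)))).
(** The three nonconstant coefficients in degree 4, hence no weight; the constant one contributes
    the factor [gauss]. *)
Definition count_all3 t := vsum (fun a => vsum (fun b => vsum (fun c =>
  vmono (phase t (newton25 c b a (0, 0))%N) 1))).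
Definition gauss t q := vsum (fun a => vmono (phase t a) (weight q a)).

Lemma vsum_els (R : nmodType) (val : vec -> R) f : {morph val : u v / vadd u v >-> u + v} ->
  val (0, 0, 0, 0, 0) = 0 -> val (vsum f) = \sum_(x <- els25) val (f x).
Proof.
move=> vD v0; rewrite /vsum; elim: els25 => [|x s IH] /=; first by rewrite big_nil.
by rewrite big_cons vD IH.
Qed.

(** * Comparison of the integer model with F_25 and [C] *)

Section CharacterSums.
Variables (C : fieldType) (zeta : C).
Hypotheses (zeta5 : zeta ^+ 5 = 1).

Definition vval (v : vec) : C := let: (a0, a1, a2, a3, a4) := v in
  a0%:~R + a1%:~R * zeta + a2%:~R * zeta ^+ 2 + a3%:~R * zeta ^+ 3 + a4%:~R * zeta ^+ 4.

Lemma vvalD : {morph vval : u v / vadd u v >-> u + v}.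
Proof.
by move=> [[[[a0 a1] a2] a3] a4] [[[[b0 b1] b2] b3] b4]; rewrite /vval /= !intrD; ring.
Qed.

Lemma vval_mono j s : vval (vmono j s) = s%:~R * zeta ^+ j.
Proof.
rewrite -(expr_mod j zeta5) /vmono; have : (j %% 5 < 5)%N by rewrite ltn_mod.
by case: (j %% 5)%N => [|[|[|[|[|]]]]] // _; rewrite /vval /=; ring.
Qed.

Lemma vval_sum f : vval (vsum f) = \sum_(x <- els25) vval (f x).
Proof. by apply: vsum_els; [exact: vvalD|rewrite /vval /=; ring]. Qed.

Variables (F : finFieldType) (lam : F).
Hypotheses (card_F : #|F| = 25%N) (lam2 : lam ^+ 2 = 2%:R).

Definition ev25 (x : p25) : F := x.1%:R + x.2%:R * lam.

Lemma natr_mod5 n : (n %% 5)%:R = n%:R :> F.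
Proof.
by rewrite [in RHS](divn_eq n 5) natrD natrM (five_F25 card_F) mulr0 add0r.
Qed.

Lemma lam5 : lam ^+ 5 = - lam.
Proof.
rewrite (_ : lam ^+ 5 = (lam ^+ 2) ^+ 2 * lam); last by ring.
rewrite lam2 (_ : 2%:R ^+ 2 = 5%:R - 1 :> F); last by ring.
by rewrite (five_F25 card_F); ring.
Qed.

Lemma lam_neq0 : lam != 0.
Proof.
apply/eqP => l0; have := lam2; rewrite l0 expr0n => /esym/eqP.
by rewrite -(dvdn_pcharf (F25_char5 card_F)).
Qed.

Lemma nat_exp5 n : (n%:R : F) ^+ 5 = n%:R.
Proof. by have := nat_pX (isT : prime 5) (m := 2) card_F n 1; rewrite expn1. Qed.

Lemma ev25_exp5 x : ev25 x ^+ 5 = x.1%:R - x.2%:R * lam.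
Proof. by rewrite /ev25 (exp5D card_F) exprMn !nat_exp5 lam5 mulrN. Qed.

Lemma ev25_add x y : ev25 (add25 x y) = ev25 x + ev25 y.
Proof. by rewrite /ev25 /= !natr_mod5 !natrD; ring. Qed.

Lemma ev25_mul x y : ev25 (mul25 x y) = ev25 x * ev25 y.
Proof.
rewrite /ev25 /= !natr_mod5 !natrD !natrM.
transitivity (x.1%:R * y.1%:R + x.2%:R * y.2%:R * lam ^+ 2 +
  (x.1%:R * y.2%:R + x.2%:R * y.1%:R) * lam : F); first by rewrite lam2; ring.
by ring.
Qed.

Lemma ev25_scal c x : ev25 (scal25 c x) = c%:R * ev25 x.
Proof. by rewrite /ev25 /= !natr_mod5 !natrM; ring. Qed.

Lemma ev25_newton r1 r2 r3 r4 :
  ev25 (newton25 r1 r2 r3 r4) = newton134 (ev25 r1) (ev25 r2) (ev25 r3) (ev25 r4).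
Proof.
rewrite /newton25 !(ev25_add, ev25_mul, ev25_scal) /newton134.
set a := ev25 r1; set b := ev25 r2; set c := ev25 r3; set d := ev25 r4.
(* The reduced coefficients differ from the original ones by the multiple of 5 displayed last. *)
transitivity (- a + (- a ^+ 3 + 3%:R * a * b - 3%:R * c) +
  (a ^+ 4 - 4%:R * a ^+ 2 * b + 2%:R * b ^+ 2 + 4%:R * a * c - 4%:R * d) +
  5%:R * (a + a ^+ 3 + c + a ^+ 2 * b + d)); first by ring.
by rewrite (five_F25 card_F); ring.
Qed.

Lemma ev25_0 : ev25 (0, 0)%N = 0. Proof. by rewrite /ev25 /= mul0r addr0. Qed.

Lemma natr_inj5 a b : (a < 5)%N -> (b < 5)%N -> a%:R = b%:R :> F -> a = b.
Proof.
move=> a5 b5; wlog le_ba : a b a5 b5 / (b <= a)%N => [th|] e.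
  by have [/th|/ltnW/th] := leqP b a; [apply|move=> h; apply/esym/h].
have /eqP : (a - b)%:R = 0 :> F by rewrite natrB // e subrr.
rewrite -(dvdn_pcharf (F25_char5 card_F)) => /dvdnP[k]; lia.
Qed.

Lemma ev25_inj : {in els25 &, injective ev25}.
Proof.
have els x : x \in els25 -> (x.1 < 5)%N /\ (x.2 < 5)%N.
  by move=> /allpairsP[[a b] []]; rewrite !mem_iota => ha hb ->.
move=> x y /els[x1 x2] /els[y1 y2] e.
(* The fifth power is the conjugation that sends lambda to its opposite; an element and its
   conjugate determine both coordinates. *)
have e5 : x.1%:R - x.2%:R * lam = y.1%:R - y.2%:R * lam by rewrite -!ev25_exp5 e.
have two0 : (2%:R : F) != 0 by rewrite -(dvdn_pcharf (F25_char5 card_F)).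
have h1 : x.1%:R = y.1%:R :> F.
  apply: (mulfI two0).
  rewrite (_ : 2%:R * x.1%:R = ev25 x + (x.1%:R - x.2%:R * lam)); last by rewrite /ev25; ring.
  by rewrite e e5 /ev25; ring.
have h2 : x.2%:R = y.2%:R :> F.
  by apply: (mulIf lam_neq0); move: e; rewrite /ev25 h1 => /addrI.
by rewrite [x]surjective_pairing [y]surjective_pairing (natr_inj5 x1 y1 h1) (natr_inj5 x2 y2 h2).
Qed.

Lemma sum_els25 (G : F -> C) : \sum_(x : F) G x = \sum_(e <- els25) G (ev25 e).
Proof.
rewrite -(big_map ev25 xpredT G); apply/esym/perm_big.
have us : uniq (map ev25 els25) by rewrite (map_inj_in_uniq ev25_inj).
apply: uniq_perm; rewrite ?index_enum_uniq // => x; rewrite mem_index_enum.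
have [_ ->] := @uniq_min_size _ (map ev25 els25) (enum F) us (fun y _ => mem_enum F y)
  (eq_leq (etrans (esym (cardE F)) card_F)).
by rewrite mem_enum.
Qed.

Local Notation psiF := (psi25 zeta).
Definition twist (t : bool) : F := if t then lam else 1.
Definition wchar (q : bool) : F -> C := if q then quad_char C (F := F) else nonzero_char C (F := F).

Lemma psi25_ev t x : psiF (twist t * ev25 x) = zeta ^+ phase t x.
Proof.
rewrite /psi25 -(prime_char_nat zeta5 _ (F25_char5 card_F)); congr prime_char.
rewrite /tr25 exprMn ev25_exp5 /twist /phase; case: t; rewrite natrM.
  rewrite lam5 /ev25 (_ : _ + _ = 2%:R * x.2%:R * lam ^+ 2); first by rewrite lam2; ring.
  by ring.
by rewrite expr1n /ev25; ring.
Qed.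

Lemma weight_ev q x : x \in els25 -> (weight q x)%:~R = wchar q (ev25 x).
Proof.
move=> xe; have z0 : (0, 0)%N \in els25 by [].
have e0 : (ev25 x == 0) = (x == (0, 0)%N).
  by rewrite -ev25_0; apply/eqP/eqP => [/(ev25_inj xe z0)|->].
rewrite /weight /wchar /quad_char /nonzero_char; case: q; rewrite e0; case: ifP => // x0.
have -> : (ev25 x ^+ 12 == 1) = ((x.1 ^ 2 + 3 * x.2 ^ 2) ^ 2 %% 5 == 1)%N.
  have -> : ev25 x ^+ 12 = ((x.1 ^ 2 + 3 * x.2 ^ 2) ^ 2 %% 5)%:R.
    rewrite natr_mod5 natrX natrD natrM !natrX.
    transitivity ((ev25 x * ev25 x ^+ 5) ^+ 2); first by ring.
    rewrite ev25_exp5 /ev25; congr (_ ^+ 2).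
    transitivity (x.1%:R ^+ 2 - x.2%:R ^+ 2 * lam ^+ 2 : F); first by ring.
    rewrite lam2 (_ : 3%:R = 5%:R - 2%:R :> F); last by ring.
    by rewrite (five_F25 card_F); ring.
  apply/eqP/eqP => [h|-> //]; apply: natr_inj5 => //; exact: ltn_mod.
by case: ifP.
Qed.

Local Notation A t q := (monic_sum (Psi zeta (wchar q) (twist t))).

(** The constant coefficient is summed outermost, as in the counts of the model. *)
Fixpoint seq_sum n (G : seq F -> C) : C :=
  if n is m.+1 then \sum_(a : F) seq_sum m (fun s => G (a :: s)) else G [::].

Lemma seq_sumS n G : seq_sum n.+1 G = \sum_(a : F) seq_sum n (fun s => G (a :: s)).
Proof. by []. Qed.

Lemma seq_sum0 G : seq_sum 0 G = G [::]. Proof. by []. Qed.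

Lemma sum_tuples n (G : seq F -> C) : \sum_(t : n.-tuple F) G t = seq_sum n G.
Proof.
elim: n G => [|n IH] G /=.
  by rewrite (big_pred1 [tuple]) // => t; apply/esym/eqP; exact: tuple0.
rewrite (eq_bigr (fun a => \sum_(t : n.-tuple F) G (a :: t))); last first.
  by move=> a _; rewrite (IH (fun s => G (a :: s))).
rewrite pair_big /= (reindex (fun at_ : F * n.-tuple F => [tuple of at_.1 :: at_.2])) //=.
exists (fun t : n.+1.-tuple F => (thead t, [tuple of behead t])) => [[a t]|t] _ /=.
  by congr (_, _); apply: val_inj.
by case/tupleP: t => a t; apply: val_inj.
Qed.

Lemma monic_sum_seq (f : {poly F} -> C) n :
  monic_sum f n = seq_sum n (fun s => f (Poly (rcons s 1))).
Proof.
by rewrite /monic_sum /monics big_map big_enum -(sum_tuples n (fun s => f (Poly (rcons s 1)))).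
Qed.

Lemma rcoef_monic (s : seq F) i : rcoef i (Poly (rcons s 1)) =
  if (i <= size s)%N then (rcons s 1)`_(size s - i) else 0.
Proof. by rewrite /rcoef polyseq_monic size_rcons coef_poly ltnS polyseq_monic. Qed.

Lemma Psi_monic t q (s : seq F) : Psi zeta (wchar q) (twist t) (Poly (rcons s 1)) =
  wchar q (rcons s 1)`_0 * psiF (twist t * hsum (Poly (rcons s 1))).
Proof. by rewrite /Psi horner_coef0 polyseq_monic. Qed.

Lemma monic_sum0 t q : A t q 0 = 1.
Proof.
rewrite monic_sum_seq seq_sum0 Psi_monic /hsum !rcoef_monic /=.
rewrite /newton134 (_ : twist t * _ = 0); last by ring.
rewrite (psi25_0 zeta5 card_F) mulr1 /wchar; case: q.
  by rewrite /quad_char oner_eq0 expr1n eqxx.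
by rewrite /nonzero_char oner_eq0.
Qed.

Lemma monic_sum1 t q : A t q 1 = vval (count1 t q).
Proof.
rewrite monic_sum_seq seq_sumS sum_els25 vval_sum.
rewrite big_seq [RHS]big_seq; apply: eq_bigr => a ha.
rewrite seq_sum0 Psi_monic /hsum !rcoef_monic /=.
by rewrite -ev25_0 -ev25_newton psi25_ev vval_mono weight_ev.
Qed.

Lemma monic_sum2 t q : A t q 2 = vval (count2 t q).
Proof.
rewrite monic_sum_seq seq_sumS sum_els25 vval_sum.
rewrite big_seq [RHS]big_seq; apply: eq_bigr => a ha.
rewrite seq_sumS sum_els25 vval_sum; apply: eq_bigr => b _.
rewrite seq_sum0 Psi_monic /hsum !rcoef_monic /=.
by rewrite -ev25_0 -ev25_newton psi25_ev vval_mono weight_ev.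
Qed.

Lemma monic_sum3 t q : A t q 3 = vval (count3 t q).
Proof.
rewrite monic_sum_seq seq_sumS sum_els25 vval_sum.
rewrite big_seq [RHS]big_seq; apply: eq_bigr => a ha.
rewrite seq_sumS sum_els25 vval_sum; apply: eq_bigr => b _.
rewrite seq_sumS sum_els25 vval_sum; apply: eq_bigr => c _.
rewrite seq_sum0 Psi_monic /hsum !rcoef_monic /=.
by rewrite -ev25_0 -ev25_newton psi25_ev vval_mono weight_ev.
Qed.

(* In degree 4 the constant coefficient enters hsum linearly, with coefficient -4. *)
Lemma monic_sum4 t q : A t q 4 = vval (gauss t q) * vval (count_all3 t).
Proof.
rewrite monic_sum_seq seq_sumS sum_els25 [vval (gauss _ _)]vval_sum mulr_suml.
rewrite big_seq [RHS]big_seq; apply: eq_bigr => a ha.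
rewrite seq_sumS sum_els25 [vval (count_all3 _)]vval_sum mulr_sumr; apply: eq_bigr => b _.
rewrite seq_sumS sum_els25 vval_sum mulr_sumr; apply: eq_bigr => c _.
rewrite seq_sumS sum_els25 vval_sum mulr_sumr; apply: eq_bigr => d _.
rewrite seq_sum0 Psi_monic /hsum !rcoef_monic /=.
rewrite (_ : newton134 _ _ _ _ = ev25 a + ev25 (newton25 d c b (0, 0)%N)).
  by rewrite mulrDr (psi25D zeta5 card_F) !psi25_ev !vval_mono mul1r weight_ev // mulrA.
rewrite ev25_newton ev25_0 /newton134.
transitivity (newton134 (ev25 d) (ev25 c) (ev25 b) 0 + (1 - 5%:R) * ev25 a).
  by rewrite /newton134; ring.
by rewrite (five_F25 card_F) /newton134; ring.
Qed.

Lemma twist_neq0 t : twist t != 0.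
Proof. by case: t; rewrite /twist ?lam_neq0 ?oner_eq0. Qed.

(* Translating the coefficient r_4 multiplies Psi by a nontrivial constant. *)
Lemma monic_sum_gt4 t q n : zeta ^+ 2 != 1 -> (4 < n)%N -> A t q n = 0.
Proof.
(* Adding c to r_4 changes [hsum] by -4c, so the argument of psi moves by -4 = 1 and the factor is
   psi(1) = zeta^2. As 4 < n, the constant coefficient and its weight stay unchanged. *)
move=> z2 n4; pose c := (twist t)^-1; pose s (u : {poly F}) := u + c *: 'X^(n - 4).
have szX : (size (c *: 'X^(n - 4)) <= n)%N.
  by rewrite (leq_trans (size_scale_leq _ _)) // size_polyXn; lia.
have smem c' u : u \in monics F n -> u + c' *: 'X^(n - 4) \in monics F n.
  rewrite !mem_monics => /andP[mu /eqP su].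
  have sz : (size (c' *: 'X^(n - 4) : {poly F}) < size u)%N.
    by rewrite su ltnS (leq_trans (size_scale_leq _ _)) // size_polyXn; lia.
  by rewrite monicE lead_coefDl // -monicE mu size_polyDl // su eqxx.
have sperm : perm_eq (map s (monics F n)) (monics F n).
  apply: uniq_perm; rewrite ?uniq_monics //.
    by rewrite map_inj_uniq ?uniq_monics // => u v /addIr.
  move=> u; apply/mapP/idP => [[v vm ->]|um]; first exact: smem.
  exists (u - c *: 'X^(n - 4)); last by rewrite /s subrK.
  by rewrite -scaleNr; apply: smem.
have Ps u : u \in monics F n ->
    Psi zeta (wchar q) (twist t) (s u) = zeta ^+ 2 * Psi zeta (wchar q) (twist t) u.
  move=> um; have := smem c u um; move: um; rewrite !mem_monics => /andP[mu /eqP su].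
  move=> /andP[ms /eqP ss]; rewrite /Psi -/(s u).
  have -> : (s u).[0] = u.[0].
    by rewrite /s !hornerE expr0n (_ : (n - 4 == 0)%N = false) ?mulr0 ?addr0 //; lia.
  have rc i : rcoef i (s u) = rcoef i u + (if i == 4%N then c else 0).
    rewrite /rcoef ss su /= !coef_poly; case: ltnP => [i_n|n_i]; last first.
      by rewrite (_ : (i == 4%N) = false) ?addr0 //; lia.
    rewrite /s coefD coefZ coefXn (_ : (n - i == n - 4)%N = (i == 4%N)); last by lia.
    by case: eqP => _; rewrite ?mulr1 ?mulr0.
  have -> : hsum (s u) = hsum u - 4%:R * c.
    by rewrite /hsum !rc /= /newton134; ring.
  have -> : twist t * (hsum u - 4%:R * c) = twist t * hsum u + 1.
    rewrite mulrBr mulrCA /c mulfV ?twist_neq0 // mulr1.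
    rewrite (_ : twist t * hsum u + 1 = twist t * hsum u - 4%:R + 5%:R); last by ring.
    by rewrite (five_F25 card_F) addr0.
  rewrite (psi25D zeta5 card_F) (_ : psiF 1 = zeta ^+ 2); first by ring.
  by have := psi25_ev false (1, 0)%N; rewrite /ev25 /phase /= mul0r addr0 mulr1.
have : A t q n = zeta ^+ 2 * A t q n.
  rewrite /monic_sum mulr_sumr -[LHS](perm_big _ sperm) big_map big_seq [RHS]big_seq.
  by apply: eq_bigr => u um; exact: Ps.
move/eqP; rewrite -subr_eq0 -{1}[A t q n]mul1r -mulrBl mulf_eq0 subr_eq0 eq_sym.
by rewrite (negbTE z2) => /eqP.
Qed.

End CharacterSums.

(** * Lower hulls and divisibility in Z[zeta] *)

Section Hull.
Local Open Scope classical_set_scope.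
Variable R : realType.
Implicit Types (A : set (R * R)) (s k : R).

(** Half-planes are convex, so one affine bound on the points controls the whole polygon. *)
Lemma conv_hull_above A s k : (forall P, A P -> s * P.1 - k <= P.2) ->
  forall P, conv_hull A P -> s * P.1 - k <= P.2.
Proof.
move=> hA P [m [t [v [t0 t1 vA -> ->]]]].
have -> : s * (\sum_(i < m) t i * (v i).1) - k = \sum_(i < m) t i * (s * (v i).1 - k).
  rewrite -[X in _ - X]mul1r -t1 mulr_sumr mulr_suml -sumrB.
  by apply: eq_bigr => i _; ring.
by apply: ler_sum => i _; apply: ler_wpM2l => //; apply: hA.
Qed.

Lemma conv_hull_sub A P : A P -> conv_hull A P.
Proof.
move=> hP; exists 1%N, (fun=> 1), (fun=> P).
by split=> //; rewrite ?big_ord1 ?mul1r // => i; exact: ler01.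
Qed.

Lemma supporting_point_lower_hull A s k P : (forall P, A P -> s * P.1 - k <= P.2) ->
  A P -> P.2 = s * P.1 - k -> lower_hull A P.
Proof.
move=> hA AP PE; split; first exact: conv_hull_sub.
by move=> y /(conv_hull_above hA) /=; rewrite PE.
Qed.

End Hull.

(** * Valuations of elements of Z[zeta] *)

Section Cyclotomic.
Local Open Scope classical_set_scope.
Variables (R : realType) (C : closedFieldType) (ord : C -> \bar R).
Hypothesis hC : is_Cp 5 ord.
Variable zeta : C.
Hypothesis hzeta : 5.-primitive_root zeta.
Local Notation vge := (ord_ge ord).

Lemma zeta_exp5 : zeta ^+ 5 = 1. Proof. exact: prim_expr_order hzeta. Qed.

Lemma zeta_exp_neq1 j : (0 < j < 5)%N -> zeta ^+ j != 1.
Proof.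
move=> /andP[j0 j5]; rewrite -(prim_order_dvd hzeta); apply/negP => /dvdn_leq.
by move/(_ j0); rewrite leqNgt j5.
Qed.

Lemma zeta_cyclotomic : 1 + zeta + zeta ^+ 2 + zeta ^+ 3 + zeta ^+ 4 = 0.
Proof.
have z1 : zeta - 1 != 0 by rewrite subr_eq0; exact: (@zeta_exp_neq1 1).
apply: (mulfI z1); rewrite mulr0.
rewrite (_ : _ * _ = zeta ^+ 5 - 1); last by ring.
by rewrite zeta_exp5 subrr.
Qed.

Lemma vge0_zeta : vge 0 zeta.
Proof.
have z0 : zeta != 0.
  by apply/eqP => z0; have /eqP := zeta_exp5; rewrite z0 expr0n eq_sym oner_eq0.
have [r hr] := ord_fin hC z0; have := ordX hC 5 hr; rewrite zeta_exp5 (ord1 hC).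
by case=> h; rewrite /ord_ge hr lee_fin; lra.
Qed.

Local Notation pi := (zeta - 1).

(** The cyclotomic relation expanded in powers of pi. *)
Lemma pi_Eisenstein : pi ^+ 4 = - (5%:R * (pi ^+ 3 + 2%:R * pi ^+ 2 + 2%:R * pi + 1)).
Proof.
apply/eqP; rewrite -subr_eq0 opprK; apply/eqP; rewrite -[RHS]zeta_cyclotomic; ring.
Qed.

(** The cofactor of 5 in [pi_Eisenstein] is 1 modulo pi, hence a unit, so 4 ord(pi) = ord(5) = 1. *)
Lemma ord_pi : ord pi = (4%:R^-1)%:E.
Proof.
have p0 : pi != 0 by rewrite subr_eq0; exact: (@zeta_exp_neq1 1).
have [r hr] := ord_fin hC p0.
have r0 : 0 <= r.
  rewrite -lee_fin -hr; apply: (vgeB hC); [exact: vge0_zeta|exact: vge01 hC].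
have v0 : vge 0 pi by rewrite /ord_ge hr lee_fin.
have h2 : vge 0 2%:R by exact: (vge0_nat hC).
have rgt0 : 0 < r.
  have : vge 1 (pi ^+ 4).
    rewrite pi_Eisenstein (vgeN hC); apply: (vgeMr hC); first exact: (vge_p hC).
    by rewrite !(vgeD hC) ?(vge0M hC) ?(vge0X hC) // (vge01 hC).
  by rewrite /ord_ge (ordX hC 4 hr) lee_fin; lra.
set w := pi ^+ 3 + 2%:R * pi ^+ 2 + 2%:R * pi + 1.
have ow : ord w = 0%:E.
  apply: (ord_close hC (ord1 hC)).
  rewrite (_ : 1 - w = - ((pi ^+ 2 + 2%:R * pi + 2%:R) * pi)); last by rewrite /w; ring.
  rewrite (ordN hC); apply: (vgt0Ml hC); last by rewrite hr lte_fin.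
  apply: (vgeD hC) => //; apply: (vgeD hC); first exact: (vge0X hC).
  exact: (vge0M hC).
have := ordX hC 4 hr; rewrite pi_Eisenstein (ordN hC) (ordMr hC (Cp_ord_p hC) ow).
by case=> e; rewrite hr; congr (_%:E); lra.
Qed.

(** Coefficients of sum_i u_i (1 + pi)^i in powers of pi = zeta - 1. *)
Definition taylor (u : vec) : seq int := let: (u0, u1, u2, u3, u4) := u in
  [:: u0 + u1 + u2 + u3 + u4; u1 + 2%:Z * u2 + 3%:Z * u3 + 4%:Z * u4;
      u2 + 3%:Z * u3 + 6%:Z * u4; u3 + 4%:Z * u4; u4].

(** Subtracting v4 times the cyclotomic relation clears the last coordinate before the division;
    with d = 1 this is a normal form. *)
Definition vdiv (d : int) (v : vec) : vec := let: (v0, v1, v2, v3, v4) := v in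
  (((v0 - v4) %/ d)%Z, ((v1 - v4) %/ d)%Z, ((v2 - v4) %/ d)%Z, ((v3 - v4) %/ d)%Z, 0).

(* v lies in 5^a (zeta - 1)^b Z[zeta]. *)
Definition divisible_by (a b : nat) (v : vec) : bool :=
  let: (v0, v1, v2, v3, v4) := v in
  all (fun x => (Posz (5 ^ a) %| x - v4)%Z) [:: v0; v1; v2; v3] &&
  all (fun x => (5%:Z %| x)%Z) (take b (taylor (vdiv (Posz (5 ^ a)) v))).

(** After division by 5^a there remains m0 + m1 pi + m2 pi^2 + m3 pi^3. The terms of index at least
    b are multiples of pi^b, the others multiples of 5, whose valuation 1 is at least b/4. *)
Lemma vge_vval a b v : (b <= 4)%N -> divisible_by a b v ->
  vge (a%:R + b%:R / 4%:R) (vval zeta v).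
Proof.
case: v => [[[[v0 v1] v2] v3] v4] b4.
set x := vval zeta _ => /andP[/= /and5P[d0 d1 d2 d3 _]].
set u0 := ((v0 - v4) %/ _)%Z; set u1 := ((v1 - v4) %/ _)%Z.
set u2 := ((v2 - v4) %/ _)%Z; set u3 := ((v3 - v4) %/ _)%Z.
move=> hT.
pose m0 := u0 + u1 + u2 + u3 + 0; pose m1 := u1 + 2%:Z * u2 + 3%:Z * u3 + 4%:Z * 0.
pose m2 := u2 + 3%:Z * u3 + 6%:Z * 0; pose m3 := u3 + 4%:Z * 0.
have hp : vge 4%:R^-1 pi by rewrite /ord_ge ord_pi.
have -> : x = 5%:R ^+ a *
    (m0%:~R + m1%:~R * pi + m2%:~R * pi ^+ 2 + m3%:~R * pi ^+ 3).
  have e v u : (Posz (5 ^ a) %| v - v4)%Z -> u = ((v - v4) %/ Posz (5 ^ a))%Z ->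
      v%:~R = 5%:R ^+ a * u%:~R + v4%:~R :> C.
    move=> /divzK h ->; rewrite -{1}(subrK v4 v) -{1}h intrD intrM mulrC.
    by rewrite -natrX.
  rewrite /x /vval (e _ u0 d0) // (e _ u1 d1) // (e _ u2 d2) // (e _ u3 d3) //.
  have -> : 5%:R ^+ a * u0%:~R + v4%:~R + (5%:R ^+ a * u1%:~R + v4%:~R) * zeta +
     (5%:R ^+ a * u2%:~R + v4%:~R) * zeta ^+ 2 + (5%:R ^+ a * u3%:~R + v4%:~R) * zeta ^+ 3 +
     v4%:~R * zeta ^+ 4 = 5%:R ^+ a * (u0%:~R + u1%:~R * zeta + u2%:~R * zeta ^+ 2 +
     u3%:~R * zeta ^+ 3) + v4%:~R * (1 + zeta + zeta ^+ 2 + zeta ^+ 3 + zeta ^+ 4) :> C by ring.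
  rewrite zeta_cyclotomic mulr0 addr0; congr (_ * _).
  rewrite /m0 /m1 /m2 /m3 !(intrD, intrM); ring.
apply: (vgeM hC); first by have := vgeX hC a (vge_p hC).
have term i (m : int) : (i < b)%N && (5%:Z %| m)%Z || (b <= i)%N ->
    vge (b%:R / 4%:R) (m%:~R * pi ^+ i).
  case/orP => [/andP[ib /dvdzP[m' ->]]|bi].
    rewrite intrM; apply: (vgeMr hC); last first.
      by apply: (vge0X hC); apply: vge_le hp; rewrite invr_ge0.
    apply: (vgeMl hC); first exact: (vge0_int hC).
    apply: vge_le (vge_p hC); rewrite ler_pdivrMr // mul1r ler_nat //.
  apply: (vgeMl hC); first exact: (vge0_int hC).
  apply: vge_le (vgeX hC i hp); rewrite -[4%:R^-1 *+ i]mulr_natl ler_wpM2r ?ler_nat //.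
  by rewrite invr_ge0.
have h0 : (0 < b)%N && (5%:Z %| m0)%Z || (b <= 0)%N.
  by case: (b) hT => //= ? /andP[-> _].
have h1 : (1 < b)%N && (5%:Z %| m1)%Z || (b <= 1)%N.
  by case: (b) hT => [|[]] //= ? /and3P[_ -> _].
have h2 : (2 < b)%N && (5%:Z %| m2)%Z || (b <= 2)%N.
  by case: (b) hT => [|[|[]]] //= ? /and4P[_ _ -> _].
have h3 : (3 < b)%N && (5%:Z %| m3)%Z || (b <= 3)%N.
  by case: (b) hT => [|[|[|[]]]] //= ? /and5P[_ _ _ -> _].
have := term _ _ h0; have := term _ _ h1; have := term _ _ h2; have := term _ _ h3.
by rewrite expr0 mulr1 expr1 => t3 t2 t1 t0; rewrite !(vgeD hC).
Qed.

End Cyclotomic.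

(** * The two Newton polygons *)

(** A pair (a, b) stands for the bound a + b/4. In degrees 2 and 3 the pairs meet the line of
    [monic_sum_bound] exactly, and for the quadratic character in degree 1 too. *)
Lemma divisible_count1 (t q : bool) :
  divisible_by (t && q) (if q && ~~ t then 3 else 0)%N (count1 t q).
Proof. by case: t; case: q; vm_compute. Qed.

Lemma divisible_count2 (t q : bool) :
  divisible_by (if q then t.+1 else 0)%N (if q && t then 0 else 2)%N (count2 t q).
Proof. by case: t; case: q; vm_compute. Qed.

Lemma divisible_count3 (t q : bool) :
  divisible_by (if q then t.+2 else 1)%N (if t then if q then 0 else 2 else 1)%N (count3 t q).
Proof. by case: t; case: q; vm_compute. Qed.

Lemma divisible_gauss (t q : bool) : divisible_by q 0 (gauss t q).
Proof. by case: t; case: q; vm_compute. Qed.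

Lemma divisible_count_all3 t : divisible_by 3 0 (count_all3 t).
Proof. by case: t; vm_compute. Qed.

(** Actual values, not only divisibilities, because the valuation of c_3 for f has to be exact. *)
Lemma reduced_counts_nonzero :
  [/\ vdiv 1 (count1 false false) = (4%:Z, - 1%:Z, 2%:Z, 9%:Z, 0),
      vdiv 1 (count2 false false) = (30%:Z, 51%:Z, 18%:Z, 36%:Z, 0) &
      vdiv 1 (count3 false false) = (- 35%:Z, - 50%:Z, - 145%:Z, - 45%:Z, 0)].
Proof. by vm_compute. Qed.

Lemma reduced_counts_quad :
  [/\ vdiv 1 (count1 false true) = (4%:Z, 3%:Z, 2%:Z, 1%:Z, 0),
      vdiv 1 (count2 false true) = (30%:Z, 15%:Z, 30%:Z, 0%:Z, 0) &
      vdiv 1 (count3 false true) = (25%:Z, 50%:Z, 75%:Z, - 25%:Z, 0)].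
Proof. by vm_compute. Qed.

(** * Affine lower bounds for ord c_n, and the exact valuation of c_3 for f *)

Section Bounds.
Local Open Scope classical_set_scope.
Variables (R : realType) (C : closedFieldType) (ord : C -> \bar R).
Hypothesis hC : is_Cp 5 ord.
Variable zeta : C.
Hypothesis hzeta : 5.-primitive_root zeta.
Local Notation vge := (ord_ge ord).
Variables (F : finFieldType) (lam : F).
Hypotheses (card_F : #|F| = 25%N) (lam2 : lam ^+ 2 = 2%:R).
Let zeta5 := zeta_exp5 hzeta.

Local Notation A t q := (monic_sum (Psi zeta (wchar C q) (twist lam t))).

Definition slope (t : bool) : R := if t then 1 else 3%:R / 4%:R.
Definition offset (t : bool) : R := if t then 3%:R / 2%:R else 1.

Lemma monic_sum_bound t q n :
  vge (slope t * n%:R - (if q then 0 else offset t)) (A t q n).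
Proof.
have bnd a b v : (b <= 4)%N -> divisible_by a b v -> forall B : R,
    B <= a%:R + b%:R / 4%:R -> vge B (vval zeta v).
  by move=> b4 /(vge_vval hC hzeta b4) h B; move/vge_le; apply.
have bnd2 a v b w : divisible_by a 0 v -> divisible_by b 0 w -> forall B : R,
    B <= a%:R + b%:R -> vge B (vval zeta v * vval zeta w).
  move=> /(vge_vval hC hzeta (leq0n 4)) h1 /(vge_vval hC hzeta (leq0n 4)) h2 B hB.
  by apply: vge_le (vgeM hC h1 h2); rewrite !mul0r !addr0.
case: n => [|[|[|[|[|n]]]]].
- rewrite (monic_sum0 zeta5 lam card_F) /ord_ge (ord1 hC) lee_fin.
  by case: t; case: q; rewrite /slope /offset; lra.
- rewrite (monic_sum1 zeta5 card_F lam2); apply: (bnd _ _ _ _ (divisible_count1 t q)).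
    by case: t; case: q.
  by case: t; case: q; rewrite /slope /offset /=; lra.
- rewrite (monic_sum2 zeta5 card_F lam2); apply: (bnd _ _ _ _ (divisible_count2 t q)).
    by case: t; case: q.
  by case: t; case: q; rewrite /slope /offset /=; lra.
- rewrite (monic_sum3 zeta5 card_F lam2); apply: (bnd _ _ _ _ (divisible_count3 t q)).
    by case: t; case: q.
  by case: t; case: q; rewrite /slope /offset /=; lra.
- rewrite (monic_sum4 zeta5 card_F lam2).
  apply: (bnd2 _ _ _ _ (divisible_gauss t q) (divisible_count_all3 t)).
  by case: t; case: q; rewrite /slope /offset /=; lra.
rewrite (monic_sum_gt4 zeta5 card_F lam2) ?(vge0 hC) //.
exact: (zeta_exp_neq1 hzeta).
Qed.

Definition Lcoef25 t n : C := \sum_(i < n.+1) A t false i * A t true (n - i)%N.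

(** Both factors obey the same slope, so it adds up along the convolution, and only the trivial
    character contributes an offset. *)
Lemma Lcoef25_bound t n : vge (slope t * n%:R - offset t) (Lcoef25 t n).
Proof.
apply: (vge_sum hC) => i _.
apply: vge_le (vgeM hC (monic_sum_bound t false i) (monic_sum_bound t true (n - i))).
rewrite natrB; last by rewrite -ltnS.
lra.
Qed.

(** In powers of pi, c_3 is 5 (60 + 74 pi + 82 pi^2 + 28 pi^3). As 5 does not divide 74 and 60 has
    valuation 1 > 1/4, the term 74 pi dominates. *)
Lemma ord_Lcoef25 : ord (Lcoef25 false 3) = (5%:R / 4%:R)%:E.
Proof.
have [c10 c20 c30] := reduced_counts_nonzero; have [c11 c21 c31] := reduced_counts_quad.
have vred v : vval zeta v = vval zeta (vdiv 1 v).
  case: v => [[[[v0 v1] v2] v3] v4]; rewrite /vdiv !divz1 /vval !intrB.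
  apply/eqP; rewrite -subr_eq0; apply/eqP.
  transitivity (v4%:~R * (1 + zeta + zeta ^+ 2 + zeta ^+ 3 + zeta ^+ 4)); first by ring.
  by rewrite (zeta_cyclotomic hzeta) mulr0.
have a10 := etrans (monic_sum1 zeta5 card_F lam2 false false)
  (etrans (vred _) (congr1 (vval zeta) c10)).
have a20 := etrans (monic_sum2 zeta5 card_F lam2 false false)
  (etrans (vred _) (congr1 (vval zeta) c20)).
have a30 := etrans (monic_sum3 zeta5 card_F lam2 false false)
  (etrans (vred _) (congr1 (vval zeta) c30)).
have a11 := etrans (monic_sum1 zeta5 card_F lam2 false true)
  (etrans (vred _) (congr1 (vval zeta) c11)).
have a21 := etrans (monic_sum2 zeta5 card_F lam2 false true)
  (etrans (vred _) (congr1 (vval zeta) c21)).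
have a31 := etrans (monic_sum3 zeta5 card_F lam2 false true)
  (etrans (vred _) (congr1 (vval zeta) c31)).
pose pi := zeta - 1.
have -> : Lcoef25 false 3 = 5%:R * (pi * (74%:R + pi * (82%:R + 28%:R * pi)) + 5%:R * 12%:R).
  have -> : Lcoef25 false 3 = A false false 0 * A false true 3 +
      A false false 1 * A false true 2 + A false false 2 * A false true 1 +
      A false false 3 * A false true 0.
    rewrite /Lcoef25 4!big_ord_recr big_ord0.
    by congr (_ + _ + _ + _); exact: add0r.
  rewrite !(monic_sum0 zeta5 lam card_F) a10 a20 a30 a11 a21 a31.
  (* The last factor is the quotient in the division by the cyclotomic polynomial. *)
  transitivity (5%:R * (pi * (74%:R + pi * (82%:R + 28%:R * pi)) + 5%:R * 12%:R) +
    (1 + zeta + zeta ^+ 2 + zeta ^+ 3 + zeta ^+ 4) *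
    (30%:R + 324%:R * zeta ^+ 1 + 36%:R * zeta ^+ 2)).
    by rewrite /vval /pi; ring.
  by rewrite (zeta_cyclotomic hzeta) mul0r addr0.
have hp : ord pi = (4%:R^-1)%:E by exact: ord_pi.
have p0 : vge 0 pi by rewrite /ord_ge hp lee_fin invr_ge0.
have hu : ord (74%:R + pi * (82%:R + 28%:R * pi)) = 0%:E.
  apply: (ord_close hC (ord_unit_nat (isT : prime 5) hC (isT : ~~ (5 %| 74)%N))).
  rewrite opprD addNKr (ordN hC) mulrC; apply: (vgt0Ml hC); last by rewrite hp lte_fin invr_gt0.
  exact: (vgeD hC (vge0_nat hC 82) (vge0M hC (vge0_nat hC 28) p0)).
have h1 := ordMr hC hp hu; rewrite addr0 in h1.
have h2 : ord (pi * (74%:R + pi * (82%:R + 28%:R * pi)) + 5%:R * 12%:R) = (4%:R^-1)%:E.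
  apply: (ord_close hC h1); rewrite opprD addNKr (ordN hC).
  apply: (@lt_le_trans _ _ 1%:E); first by rewrite lte_fin; lra.
  exact: (vgeMr hC (vge_p hC) (vge0_nat hC 12)).
by rewrite (ordMr hC (Cp_ord_p hC) h2); congr (_%:E); lra.
Qed.

End Bounds.

(** * Identification of the L-function with the product of the two factors *)

Section LCoefficients.
Local Open Scope classical_set_scope.
Variables (R : realType) (C : closedFieldType) (ord : C -> \bar R).
Hypothesis hC : is_Cp 5 ord.
Variable zeta : C.
Hypothesis hzeta : 5.-primitive_root zeta.
Variable Q : nat -> local_ext C.
Hypothesis hQ : forall n : nat, (0 < n)%N -> is_unramified 5 ord n (Q n).
Let pr5 : prime 5 := isT.

Local Notation F := (resfield (Q 2%N)).

Lemma card_F25 : #|F| = 25%N. Proof. by rewrite (unram_resdegree (hQ (isT : (0 < 2)%N))). Qed.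

(* Only k > 0 matters; the shift avoids [Q 0], about which nothing is known. *)
Definition resfield_tower k : finFieldType := resfield (Q (2 * k.-1.+1)%N).

Lemma card_tower k : (0 < k)%N -> #|resfield_tower k| = (#|F| ^ k)%N.
Proof.
by case: k => // k _; rewrite (unram_resdegree (hQ (isT : (0 < 2 * k.+1)%N))) card_F25 expnM.
Qed.

Let embedding_exists k := residue_embedding (isT : prime 5) hC (isT : (0 < 2)%N)
  (ltn0Sn k.-1) (hQ (isT : (0 < 2)%N)) (hQ (isT : (0 < 2 * k.-1.+1)%N)).

Definition embedding k : {rmorphism F -> resfield_tower k} :=
  sval (cid (embedding_exists k)).

(** The sums S_k split as in [point_sum_split], so the convolution of the two Euler recurrences
    satisfies the recurrence that determines [exp_coef]. *)
Lemma L_coef_conv (lam : F) t n :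
  let f : {poly F} := 'X^8 + 'X^6 + 'X^2 in
  L_coef ord zeta (twist lam t *: f) n = Lcoef25 zeta lam t n.
Proof.
move=> f; have zeta5 := zeta_exp5 hzeta; have cF := card_F25.
have wM q : {morph wchar C (F := F) q : c d / c * d}.
  by case: q => c d; rewrite /wchar ?(quad_charM _ cF) ?nonzero_charM.
have rec q := euler_recurrence embedding card_tower
  (PsiM zeta5 cF (twist lam t) (wM q)).
have expE k : (0 < k)%N -> exp_sum ord zeta (twist lam t *: f) k =
    point_sum embedding (Psi zeta (wchar C false) (twist lam t)) k +
    point_sum embedding (Psi zeta (wchar C true) (twist lam t)) k.
  case: k => // k k0; rewrite /point_sum /wchar.
  rewrite -(point_sum_split zeta5 cF (embedding k.+1) k0 (card_tower k0)).
  apply: eq_bigr => u _; rewrite /teichmuller_poly /psiE.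
  have eE := svalP (cid (embedding_exists k.+1)).
  rewrite (expZp_trace_residue pr5 hC (isT : (0 < 2)%N) k0 (hQ (isT : (0 < 2)%N))
    (hQ (isT : (0 < 2 * k.+1)%N)) _ u zeta5 eE) -/(embedding k.+1).
  congr prime_char; apply: eq_bigr => i _; congr (_ ^+ _).
  by rewrite /f map_polyZ !rmorphD /= !map_polyXn hornerZ !hornerD !hornerXn.
apply: (recurrence_unique (Cp_char0 pr5 hC) (c := Lcoef25 zeta lam t)).
  by rewrite /Lcoef25 big_ord_recl big_ord0 !(monic_sum0 zeta5 lam cF) mulr1 addr0.
move=> m; rewrite (convolution_recurrence (rec false) (rec true)).
rewrite big_nat [RHS]big_nat; apply: eq_bigr => k /andP[k0 _].
by rewrite expE.
Qed.

End LCoefficients.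

Theorem theorem1p3 (R : realType) (C : closedFieldType) (ord : C -> \bar R)
    (hC : is_Cp 5 ord)
    (zeta : C) (hzeta : 5.-primitive_root zeta)
    (Q : nat -> local_ext C)
    (hQ : forall n : nat, (0 < n)%N -> is_unramified 5 ord n (Q n))
    (xi : resfield (Q 2%N))
    (hxi : root ('X^2 + 4%:R *: 'X + 2%:R%:P) xi) :
  let f : {poly resfield (Q 2%N)} := 'X^8 + 'X^6 + 'X^2 in
  let lambda : resfield (Q 2%N) := xi + 2%:R in
  NP ord zeta f <> NP ord zeta (lambda *: f).
Proof.
move=> f lambda.
have cF := card_F25 hQ.
have lam2 : lambda ^+ 2 = 2%:R.
  move: hxi; rewrite rootE !hornerD hornerXn hornerZ hornerX hornerC => /eqP h.
  transitivity ((xi ^+ 2 + 4%:R * xi + 2%:R) + 2%:R); last by rewrite h add0r.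
  by rewrite /lambda; ring.
have above t P : newton_points ord zeta (twist lambda t *: f) P ->
    slope R t * P.1 - offset R t <= P.2.
  move=> [n [_ -> cn]]; rewrite -lee_fin -cn (L_coef_conv hC hzeta hQ).
  exact: (Lcoef25_bound hC hzeta cF lam2).
have fE : twist lambda false *: f = f by rewrite /twist scale1r.
have fP : newton_points ord zeta f (3%:R, 5%:R / 4%:R).
  exists 3%N; split=> //; last first.
    by rewrite -fE (L_coef_conv hC hzeta hQ) (ord_Lcoef25 hC hzeta cF lam2).
  have : (8 < size f)%N.
    rewrite ltnNge; apply/negP => /leq_sizeP/(_ 8%N (leqnn _))/eqP.
    by rewrite /f !coefD !coefXn /= !addr0 oner_eq0.
  by case: (size f) => // n; rewrite ltnS; apply: leq_trans.
have NPf : NP ord zeta f (3%:R, 5%:R / 4%:R).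
  apply: (@supporting_point_lower_hull _ _ (slope R false) (offset R false)) => //.
    by move=> P; rewrite -fE; exact: above.
  by rewrite /slope /offset /=; lra.
(* Equality would put (3, 5/4) in the hull for lambda f, which lies above x - 3/2, equal to 3/2 at x
   = 3. *)
move=> NPE; move: NPf; rewrite NPE => -[hull _].
have := conv_hull_above (above true) hull; rewrite /slope /offset /=; lra.
Qed.
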